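(* For all $a\in(-1,0)$, there exists $\xi<0$ such that $\mu_a(\xi)$, the first eigenvalue of the operator $\mathfrak h_a[\xi]$, satisfies $$\mu_a(\xi)<|a|.$$ Consequently, the function $\mathbb R\ni\xi\mapsto\mu_a(\xi)$ admits a global minimum satisfying $$\min_{\xi\in\mathbb R}\mu_a(\xi)<|a|.$$
   Context: For $a\in[-1,1)\setminus\{0\}$ and $\xi\in\mathbb R$, let $V_a(\xi,t)=(\xi+at)^2$ for $t<0$ and $V_a(\xi,t)=(\xi+t)^2$ for $t>0$. $\mathfrak h_a[\xi]=-\frac{d^2}{dt^2}+V_a(\xi,t)$ is the self-adjoint operator on $L^2(\mathbb R)$ associated with the quadratic form $q_a[\xi](u)=\int_{\mathbb R}\big(|u'(t)|^2+V_a(\xi,t)|u(t)|^2\big)dt$ with form domain $B^1(\mathbb R)=\{u\in L^2(\mathbb R):u'\in L^2(\mathbb R),\ tu\in L^2(\mathbb R)\}$. It has compact resolvent, and $$\mu_a(\xi)=\inf_{u\in B^1(\mathbb R),\,u\ne0}\frac{q_a[\xi](u)}{\|u\|^2_{L^2(\mathbb R)}}$$ is its first eigenvalue. *)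

(* Defs.v *)
From mathcomp Require Import all_boot all_order all_algebra.
From mathcomp.real_closed Require Import complex.
From mathcomp Require Import all_classical all_reals all_analysis.
Set Implicit Arguments.
Unset Strict Implicit.
Unset Printing Implicit Defensive.
Import Order.TTheory GRing.Theory Num.Theory.
Import numFieldNormedType.Exports.

Local Open Scope classical_set_scope.
Local Open Scope ring_scope.

Section piecewise_parabolic_well.
Context {R : realType}.
Local Notation leb := (@lebesgue_measure R).
Implicit Types (a xi t : R) (u v : R -> R[i]).

Definition sqnormc (z : R[i]) : R := complex.Re z ^+ 2 + complex.Im z ^+ 2.

(* Elements of L^2(R) are represented by functions, not by classes modulo
   almost everywhere equality. *)
Definition L2 u : Prop :=
  (fun t => complex.Re (u t)) \in Lfun leb 2%:E /\ (fun t => complex.Im (u t)) \in Lfun leb 2%:E.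

Definition C1c (phi : R -> R) : Prop :=
  [/\ forall t, derivable phi t 1, continuous (derive1 phi)
    & exists M : R, forall t, M < `|t| -> phi t = 0].

(* Weak derivative tested against C^1_c.  Real-valued test functions suffice,
   by linearity, also for the components of a complex function. *)
Definition weak_derivative (f g : R -> R) : Prop := forall phi, C1c phi ->
  (\int[leb]_t (f t * derive1 phi t))%R = - (\int[leb]_t (g t * phi t))%R.

Definition L2_derivative u v : Prop :=
  [/\ L2 v,
      weak_derivative (fun t => complex.Re (u t)) (fun t => complex.Re (v t))
    & weak_derivative (fun t => complex.Im (u t)) (fun t => complex.Im (v t))].

(* Determined almost everywhere by u whenever u has a weak derivative in
   L^2(R); the default value 0 is irrelevant on B1. *)
Definition weak_deriv u : R -> R[i] := xget (fun=> 0) (L2_derivative u).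

Definition B1 u : Prop :=
  [/\ L2 u, exists v, L2_derivative u v & L2 (fun t => t%:C%C * u t)].

(* The value at t = 0 is immaterial. *)
Definition V a xi t : R :=
  if t < 0 then (xi + a * t) ^+ 2 else (xi + t) ^+ 2.

(* On B1 both integrands below are integrable. *)
Definition q a xi u : R :=
  \int[leb]_t (sqnormc (weak_deriv u t) + V a xi t * sqnormc (u t)).

Definition sqnormL2 u : R := \int[leb]_t sqnormc (u t).

(* The set of Rayleigh quotients is nonempty and bounded below by 0, so the
   real-valued inf is the true infimum. *)
Definition mu a xi : R :=
  inf [set q a xi u / sqnormL2 u
      | u in [set u | B1 u /\ ~ {ae leb, forall t, u t = 0}]].

End piecewise_parabolic_well.

(* Main.v *)
Require Import Defs.
From mathcomp Require Import all_boot all_order all_algebra.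
From mathcomp.real_closed Require Import complex.
From mathcomp Require Import all_classical all_reals all_analysis.
From mathcomp Require Import measurable_realfun.
From mathcomp Require Import ring lra.
Set Implicit Arguments.
Unset Strict Implicit.
Unset Printing Implicit Defensive.
Import Order.TTheory GRing.Theory Num.Theory.
Import numFieldNormedType.Exports.
Local Open Scope classical_set_scope.
Local Open Scope ring_scope.

(** Write b = |a|, so that 0 < b < 1, and v for a weak derivative of u.

    Why the infimum drops below b.  The gaussian exp (- (1 + b t)^2 / (2 b)) is
    the ground state, with energy b, of the oscillator - u'' + (1 + b t)^2 u,
    whose potential is that of the operator at xi = -1 for t < 0.  For t > 0
    the true potential is (t - 1)^2, and the difference
    (1 + b) t ((1 - b) t - 2) has a negative integral against the squared
    gaussian: once the derivative of a function vanishing at both ends is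
    removed, the excess energy density is nonpositive, and negative for t > 0
    ([gauss_energy_pointwise]).  Hence mu (-1) < b.

    Why a minimum exists.  With d = |xi - xi'| one has pointwise
    V xi' <= (1 + d) (V xi + d), so mu is continuous, and it remains to see that
    mu exceeds mu (-1) outside a compact interval.  For xi >= 0 the potential
    is at least xi^2.  For xi = - x with x > 0 the potential has two wells, of
    slope b at - x / b and of slope 1 at x, and mu (- x) >= b - 36 / x^2
    ([mu_ge_far]).  To prove this bound, expand (v - g u)^2 >= 0 for a
    compactly supported C^1 function g: since the integral of
    2 g u v + g' u^2 vanishes ([weak_derivative_sqr_drift]), it suffices that g
    solves the Riccati inequality E + g^2 + g' <= V.  The logarithmic derivative
    - k (t - c) of the gaussian of a well of slope k centred at c solves it
    exactly with E = k; cutting it off at distance x costs at most 36 / x^2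
    ([drift_riccati]), and the two cut-off functions have disjoint supports.

    What is needed about weak derivatives.  That they are unique almost
    everywhere, so that the energy may be computed with any of them, and the
    product rule behind the vanishing integral above.  Both come from the
    fundamental lemma of the calculus of variations ([fundamental_lemma]); the
    product rule also uses that chi u, for a C^1_c function chi, is almost
    everywhere the primitive of its weak derivative ([cutoff_eq_cumul]), and
    the integration by parts formula for primitives of integrable functions,
    which is an instance of Fubini's theorem ([cumul_by_parts]). *)

Section piecewise_parabolic_ground_energy.
Context {R : realType}.
Local Notation leb := (@lebesgue_measure R).
Implicit Types (f g F G df dg phi psi : R -> R) (t c L : R).

(** * Functions of class C^1 and test functions *)

(** Carrying the derivative as data makes the chain and product rules
    compose without ever computing a limit. *)
Definition C1_deriv f df : Prop :=
  (forall t, is_derive t 1 f (df t)) /\ continuous df.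

Lemma C1_deriv_continuous f df : C1_deriv f df -> continuous f.
Proof.
move=> [fd _] t; apply: differentiable_continuous.
by apply/derivable1_diffP; have := fd t; case.
Qed.

Lemma C1_derivM f df g dg : C1_deriv f df -> C1_deriv g dg ->
  C1_deriv (fun t => f t * g t) (fun t => df t * g t + f t * dg t).
Proof.
move=> cf cg; split=> [t|t].
  have fd := cf.1 t; have gd := cg.1 t.
  apply: (is_derive_eq (is_deriveM fd gd)).
  by rewrite /GRing.scale/=; ring.
have fc := C1_deriv_continuous cf; have gc := C1_deriv_continuous cg.
apply: cvgD; apply: cvgM; [exact: cf.2|exact: gc|exact: fc|exact: cg.2].
Qed.

Lemma C1_derivD f df g dg : C1_deriv f df -> C1_deriv g dg ->
  C1_deriv (fun t => f t + g t) (fun t => df t + dg t).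
Proof.
move=> cf cg; split=> [t|t]; last by apply: cvgD; [exact: cf.2|exact: cg.2].
by have fd := cf.1 t; have gd := cg.1 t; exact: is_deriveD.
Qed.

Lemma C1_deriv_cst c : C1_deriv (fun=> c) (fun=> 0).
Proof. by split=> t; [exact: is_derive_cst|exact: cvg_cst]. Qed.

Lemma C1_deriv_id : C1_deriv id (fun=> 1).
Proof. by split=> t; [exact: is_derive_id|exact: cvg_cst]. Qed.

Lemma C1_deriv_comp f df g dg : C1_deriv f df -> C1_deriv g dg ->
  C1_deriv (fun t => f (g t)) (fun t => dg t * df (g t)).
Proof.
move=> cf cg; split=> [t|t].
  have fd := cf.1 (g t); have gd := cg.1 t.
  by apply: (is_derive_eq (is_derive1_comp fd gd)); rewrite mulrC.
have gc := C1_deriv_continuous cg.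
apply: cvgM; first exact: cg.2.
by apply: (@continuous_comp _ _ _ g df); [exact: gc|exact: cf.2].
Qed.

Lemma C1_deriv_expR : C1_deriv expR expR.
Proof. by split=> t; [exact: is_derive_expR|exact: continuous_expR]. Qed.

(** The square of the positive part is C^1 although the positive part is
    not: every cut-off below is built from it, and it switches on the
    correction term of the trial energy at t = 0. *)
Lemma C1_deriv_sqr_max0 :
  C1_deriv (fun t => Num.max 0 t ^+ 2) (fun t => 2 * Num.max 0 t).
Proof.
split=> [t|t]; last first.
  apply: cvgM; first exact: cvg_cst.
  apply: (@continuous_max _ _ (fun=> 0 : R) (fun x => x)); [exact: cvg_cst|exact: cvg_id].
have [t0|t0|->] := ltgtP t 0.
- rewrite mulr0; have [h _] := C1_deriv_cst 0.
  apply: near_eq_is_derive (h t).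
  near=> x.
  have x0 : x < 0 by near: x; exact: lt_nbhsl.
  by rewrite (max_idPl (ltW x0)) expr0n.
- have [h _] := C1_derivM C1_deriv_id C1_deriv_id.
  have := h t; rewrite mul1r mulr1 -mulr2n -(mulr_natl t) => ht.
  apply: near_eq_is_derive ht.
  near=> x.
  have x0 : 0 < x by near: x; exact: lt_nbhsr.
  by rewrite (max_idPr (ltW x0)).
- have H : h^-1 *: (Num.max 0 (h * 1 + 0 : R) ^+ 2 - Num.max 0 (0:R) ^+ 2) @[h --> (0:R)^'] -->
      (0 : R).
    apply/cvgr0Pnorm_le => e e0; near=> h.
    have h0 : h != 0 by near: h; exact: nbhs_dnbhs_neq.
    have he : `|h| <= e by near: h; exact: dnbhs0_le.
    rewrite addr0 /GRing.scale/= mulr1 maxxx expr0n/= subr0.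
    rewrite normrM normfV normrX ler_pdivrMl ?normr_gt0//.
    apply: le_trans (_ : `|h| ^+ 2 <= _); last by rewrite expr2 ler_wpM2l.
    rewrite lerXn2r ?nnegrE//.
    by rewrite /Num.max; case: ifP => _; rewrite ?normr0.
  rewrite mulr0.
  by split; [apply/cvg_ex; exists 0|apply/cvg_lim].
Unshelve. all: by end_near. Qed.

Lemma C1_deriv_derive1 f df : C1_deriv f df -> derive1 f = df.
Proof. by move=> cf; apply/funext => t; rewrite derive1E; have [_] := cf.1 t. Qed.

Lemma C1c_of_C1_deriv f df (M : R) : C1_deriv f df -> (forall t, M < `|t| -> f t = 0) ->
  C1c f.
Proof.
move=> cf fM; split; first by move=> t; have [] := cf.1 t.
  by rewrite (C1_deriv_derive1 cf); exact: cf.2.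
by exists M.
Qed.

Lemma C1c_deriv phi : C1c phi -> C1_deriv phi (derive1 phi).
Proof.
move=> [dphi cphi _]; split=> // t.
by rewrite derive1E; exact: derivableP.
Qed.

(** Outside the support the derivative vanishes as well, the complement of
    the support being open. *)
Lemma C1c_support phi : C1c phi ->
  exists M, forall t, M < `|t| -> phi t = 0 /\ derive1 phi t = 0.
Proof.
move=> [_ _ [M phiM]]; exists M => t Mt; split; first exact: phiM.
have h := (C1_deriv_cst 0).1 t.
have : is_derive t 1 phi 0.
  apply: near_eq_is_derive h; near=> x.
  rewrite phiM//; near: x.
  by apply: (cvgr_gt (`|t|)) => //; apply: cvg_norm; exact: cvg_id.
by rewrite derive1E; case.
Unshelve. all: by end_near. Qed.

Lemma C1cM phi f df : C1c phi -> C1_deriv f df -> C1c (fun t => phi t * f t).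
Proof.
move=> cphi cf; have [M phiM] := C1c_support cphi.
apply: (@C1c_of_C1_deriv _ _ M (C1_derivM (C1c_deriv cphi) cf)) => t /phiM[-> _].
by rewrite mul0r.
Qed.

(** The square makes the cut-off (1 - ((t - c) / L)^2)_+ of class C^1. *)
Definition bump c L t : R := Num.max 0 (1 - ((t - c) / L) ^+ 2) ^+ 2.

Definition dbump c L t : R :=
  - (2 * (t - c) / L ^+ 2) * (2 * Num.max 0 (1 - ((t - c) / L) ^+ 2)).

Lemma C1_deriv_bump c L : L != 0 -> C1_deriv (bump c L) (dbump c L).
Proof.
move=> L0.
have ca := C1_derivM (C1_derivD C1_deriv_id (C1_deriv_cst (- c))) (C1_deriv_cst L^-1).
have cb := C1_derivD (C1_deriv_cst 1)
  (C1_derivM (C1_deriv_cst (-1)) (C1_derivM ca ca)).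
have := C1_deriv_comp C1_deriv_sqr_max0 cb.
congr C1_deriv; apply/funext => t; rewrite /bump /dbump !mulN1r -expr2//.
by congr *%R; field.
Qed.

Lemma bump_eq0 c L t : 0 < L -> L <= `|t - c| -> bump c L t = 0.
Proof.
move=> L0 Lt; rewrite /bump max_l ?expr0n// subr_le0 -real_normK ?num_real//.
by rewrite normrM normfV (gtr0_norm L0) expr_ge1// ?divr_ge0// ?(ltW L0)// ler_pdivlMr ?mul1r.
Qed.

Lemma bump_gt0 c L t : `|t - c| < L -> 0 < bump c L t.
Proof.
move=> Lt; have L0 : 0 < L by apply: le_lt_trans Lt.
rewrite exprn_gt0// lt_max subr_gt0; apply/orP; right.
rewrite -real_normK ?num_real//.
by rewrite normrM normfV (gtr0_norm L0) expr_lt1// ?divr_ge0// ?(ltW L0)// ltr_pdivrMr ?mul1r.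
Qed.

Lemma bump_ge0 c L t : 0 <= bump c L t.
Proof. by rewrite /bump sqr_ge0. Qed.

Lemma C1c_bump c L : 0 < L -> C1c (bump c L).
Proof.
move=> L0; apply: (@C1c_of_C1_deriv _ _ (`|c| + L) (C1_deriv_bump c (lt0r_neq0 L0))) => t ct.
apply: bump_eq0 => //; have := ler_normD (t - c) c; rewrite subrK; lra.
Qed.

Lemma compact_support_integrable f (M : R) : continuous f ->
  (forall t, M < `|t| -> f t = 0) -> leb.-integrable setT (EFin \o f).
Proof.
move=> cf fM.
have -> : EFin \o f = (EFin \o f) \_ `[-M, M].
  apply/funext => t; rewrite patchE; case: ifPn => //.
  by rewrite notin_setE/= in_itv/= => /negP; rewrite -ler_norml -ltNge => /fM->.
rewrite -integrable_mkcond//.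
apply: continuous_compact_integrable; first exact: segment_compact.
exact: continuous_subspaceT.
Qed.

(** * Integrable real functions and integrals of derivatives *)

Local Notation integrableR f := (leb.-integrable setT (EFin \o f%R)).

Lemma integrableR_measurable f : integrableR f -> measurable_fun setT f.
Proof. by move/measurable_int/measurable_EFinP. Qed.

Lemma integrableRD f g : integrableR f -> integrableR g -> integrableR (fun t => f t + g t).
Proof. by move=> fi gi; exact: integrableD fi gi. Qed.

Lemma integrableRZ f c : integrableR f -> integrableR (fun t => c * f t).
Proof. by move=> fi; exact: (integrableZl _ _ fi). Qed.

Lemma integrableRB f g : integrableR f -> integrableR g -> integrableR (fun t => f t - g t).
Proof. by move=> fi gi; exact: integrableB fi gi. Qed.

Lemma integrableR_le f g : measurable_fun setT f -> integrableR g ->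
  (forall t, `|f t| <= g t) -> integrableR f.
Proof.
move=> mf gi fg; apply: le_integrable gi => //; first exact/measurable_EFinP.
by move=> t _ /=; rewrite lee_fin (le_trans (fg t))// ler_norm.
Qed.

Lemma Rintegral_dominated_cvg (f_ : nat -> R -> R) f g :
  (forall n, measurable_fun setT (f_ n)) -> (forall t, f_ ^~ t @ \oo --> f t) ->
  integrableR g -> (forall n t, `|f_ n t| <= g t) ->
  integrableR f /\ (\int[leb]_t (f_ n t) @[n --> \oo] --> \int[leb]_t (f t)).
Proof.
move=> mf_ f_f gi f_g.
have mf : measurable_fun setT f.
  by apply: (measurable_fun_cvg mf_) => t _; exact: f_f.
have [||||fi _ fc] := @dominated_convergence _ _ R leb setT measurableT
  (fun n => EFin \o f_ n) (EFin \o f) (EFin \o g) _ _ _ gi.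
- by move=> n; apply/measurable_EFinP; exact: mf_.
- by apply/measurable_EFinP; exact: mf.
- by apply: aeW => t _; apply: cvg_EFin; [exact: nearW|exact: f_f].
- by apply: aeW => t n _ /=; rewrite lee_fin.
split=> //; apply: fine_cvg; rewrite fineK//.
exact: integrable_fin_num.
Qed.

(** The integral of dF over [-n, n] is F n - F (- n), which tends to 0, and
    tends to the integral over the line by dominated convergence. *)
Lemma integral_deriv_eq0 F dF : C1_deriv F dF -> integrableR dF ->
  F n%:R @[n --> \oo] --> (0 : R) -> F (- n%:R) @[n --> \oo] --> (0 : R) ->
  \int[leb]_t (dF t) = 0.
Proof.
move=> cF dFi Fp Fm.
have Fc := C1_deriv_continuous cF.
pose f_ n t := dF t * \1_(`[- n.+1%:R, n.+1%:R]) t.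
have f_1 n t : `|f_ n t| <= `|dF t|.
  rewrite /f_ indicE; case: (_ \in _); first by rewrite mulr1.
  by rewrite mulr0 normr0.
have mf_ n : measurable_fun setT (f_ n).
  apply: measurable_funM; first exact: integrableR_measurable.
  exact: measurable_indic.
have f_c t : f_ ^~ t @ \oo --> dF t.
  apply: cvg_near_cst; near=> n.
  rewrite /f_ indicE mem_set ?mulr1//= in_itv/= -ler_norml.
  apply: (@le_trans _ _ n%:R); last by rewrite ler_nat.
  by near: n; exact: nbhs_infty_ger.
have [_ h] := Rintegral_dominated_cvg mf_ f_c (integrable_norm dFi) f_1.
have {}h : F n.+1%:R - F (- n.+1%:R) @[n --> \oo] --> \int[leb]_t (dF t).
  apply: cvg_trans h; apply: near_eq_cvg; apply: nearW => n.
  have -> : \int[leb]_t f_ n t = \int[leb]_(t in `[- n.+1%:R, n.+1%:R]) dF t.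
    rewrite [RHS]Rintegral_mkcond; apply: eq_Rintegral => t _.
    by rewrite /f_ patchE indicE; case: (_ \in _); rewrite ?mulr1 ?mulr0.
  rewrite /Rintegral (@continuous_FTC2 _ _ F)//.
  - by rewrite -subr_gt0 opprK.
  - by apply: continuous_subspaceT; exact: cF.2.
  - split.
    + by move=> t _; have [] := cF.1 t.
    + by apply: cvg_at_right_filter; exact: Fc.
    + by apply: cvg_at_left_filter; exact: Fc.
  - by move=> t _; rewrite (C1_deriv_derive1 cF).
suff h0 : F n.+1%:R - F (- n.+1%:R) @[n --> \oo] --> (0 : R).
  exact: (cvg_unique _ h h0).
rewrite -[X in _ --> X](subrr (0 : R)); apply: cvgB.
- by rewrite (cvg_shiftS (fun n => F n%:R)).
- by rewrite (cvg_shiftS (fun n => F (- n%:R))).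
Unshelve. all: by end_near. Qed.

Lemma C1c_integrableR phi : C1c phi -> integrableR phi.
Proof.
move=> cphi; have [M h] := C1c_support cphi.
apply: (@compact_support_integrable _ M); last by move=> t /h[].
exact: C1_deriv_continuous (C1c_deriv cphi).
Qed.

Lemma C1c_deriv_integrableR phi : C1c phi -> integrableR (derive1 phi).
Proof.
move=> cphi; have [M h] := C1c_support cphi.
by apply: (@compact_support_integrable _ M); [exact: (C1c_deriv cphi).2|move=> t /h[]].
Qed.

Lemma C1c_integral_deriv phi : C1c phi -> \int[leb]_t (derive1 phi t) = 0.
Proof.
move=> cphi; have [M h] := C1c_support cphi.
apply: (integral_deriv_eq0 (C1c_deriv cphi) (C1c_deriv_integrableR cphi)).
- apply: cvg_near_cst; near=> n; apply: (h _ _).1.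
  by rewrite ger0_norm//; near: n; exact: nbhs_infty_gtr.
- apply: cvg_near_cst; near=> n; apply: (h _ _).1.
  by rewrite normrN ger0_norm//; near: n; exact: nbhs_infty_gtr.
Unshelve. all: by end_near. Qed.

(** * The fundamental lemma of the calculus of variations *)

(** As n grows these test functions increase to the indicator of the open
    interval of centre c and radius L. *)
Lemma C1c_saturated_bump c L (n : nat) : 0 < L ->
  C1c (fun t => 1 - expR (- (n%:R * bump c L t))).
Proof.
move=> L0; have cb := C1_deriv_bump c (lt0r_neq0 L0).
have cn := C1_deriv_comp C1_deriv_expR (C1_derivM (C1_deriv_cst (- n%:R)) cb).
have c1 := C1_derivD (C1_deriv_cst 1) (C1_derivM (C1_deriv_cst (-1)) cn).
have [M h] := C1c_support (C1c_bump c L0).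
have := @C1c_of_C1_deriv _ _ M c1.
rewrite (_ : (fun t => 1 + -1 * _) = (fun t => 1 - expR (- (n%:R * bump c L t)))); last first.
  by apply/funext => t; rewrite mulN1r mulNr.
by apply=> t /h[-> _]; rewrite mulr0 expR0 mulN1r subrr.
Qed.

(** Dominated convergence along the saturated bumps turns the hypothesis on
    test functions into one on intervals. *)
Lemma integral_ball_eq0 f c L : 0 < L ->
  locally_integrable setT f ->
  (forall phi, C1c phi -> \int[leb]_t (f t * phi t) = 0) ->
  \int[leb]_(t in ball c L) f t = 0.
Proof.
move=> L0 [mf _ fK] f0.
pose f_ (n : nat) t := f t * (1 - expR (- (n%:R * bump c L t))).
have fc t : f_ ^~ t @ \oo --> f t * \1_(ball c L) t.
  apply: cvgM; first exact: cvg_cst.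
  have [tL|tL] := boolP (t \in (ball c L : set R)); rewrite indicE ?tL ?(negbTE tL)/=; last first.
    rewrite bump_eq0//; last first.
      by move: tL; rewrite notin_setE /ball/= => /negP; rewrite -leNgt distrC.
    by under eq_fun do rewrite mulr0 oppr0 expR0 subrr; exact: cvg_cst.
  rewrite -[X in _ --> X]subr0; apply: cvgB; first exact: cvg_cst.
  under eq_fun do rewrite -mulrN expRM_natl.
  apply: cvg_expr; rewrite ger0_norm ?expR_ge0// expR_lt1 oppr_lt0.
  by apply: bump_gt0; move: tL; rewrite inE /ball/= distrC.
have mf_ n : measurable_fun setT (f_ n).
  apply: measurable_funM => //; apply: continuous_measurable_fun.
  exact: C1_deriv_continuous (C1c_deriv (C1c_saturated_bump c n L0)).
have KE t : t \notin `[c - L, c + L] -> bump c L t = 0.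
  move=> tK; apply: bump_eq0 => //; rewrite leNgt; apply/negP => tcL.
  by move: tK; rewrite in_itv/= -ler_distl distrC (ltW (_ : `|c - t| < L))// distrC.
have fi : integrableR (f \_ `[c - L, c + L]).
  rewrite -restrict_EFin -integrable_mkcond//; apply/integrableP; split.
    by apply/measurable_EFinP; exact: measurable_funTS.
  exact: fK (@subsetT _ _) (@segment_compact _ _ _).
have [|_] := Rintegral_dominated_cvg mf_ fc (integrable_norm fi).
  move=> n t; rewrite /f_ /= patchE; case: ifPn => tK.
    rewrite normrM ler_piMr//.
    have := expR_gt0 (- (n%:R * bump c L t)).
    have : expR (- (n%:R * bump c L t)) <= 1.
      by rewrite -[leRHS]expR0 ler_expR oppr_le0 mulr_ge0// bump_ge0.
    by rewrite ler_norml; lra.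
  rewrite KE ?mulr0 ?oppr0 ?expR0 ?subrr ?mulr0 ?normr0//.
  by apply: contra tK; rewrite inE.
under eq_fun do rewrite (f0 _ (C1c_saturated_bump _ _ L0)).
move=> h; have := cvg_unique _ h (cvg_cst 0).
rewrite (_ : \int[leb]_t _ = \int[leb]_(t in ball c L) f t); first by move=> ->.
rewrite [RHS]Rintegral_mkcond; apply: eq_Rintegral => t _.
by rewrite patchE indicE; case: (_ \in _); rewrite ?mulr1 ?mulr0.
Qed.

(** At a Lebesgue point x the mean of |f - f x| over small balls tends to 0;
    it is at least |f x|, because f has zero integral over each ball. *)
Lemma fundamental_lemma f : locally_integrable setT f ->
  (forall phi, C1c phi -> \int[leb]_t (f t * phi t) = 0) ->
  {ae leb, forall t, f t = 0}.
Proof.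
move=> lf f0; have := lebesgue_differentiation lf.
apply: filterS; first exact: (ae_filter_ringOfSetsType leb).
move=> x fx.
apply/eqP; rewrite -normr_le0 -lee_fin.
have fK L : 0 < L -> leb.-integrable (ball x L) (EFin \o f).
  case: lf => mf _ fK L0; apply: (@integrableS _ _ _ leb `[x - L, x + L]%classic) => //.
  - exact: measurable_ball.
  - by rewrite ball_itv; exact: subset_itv_oo_cc.
  - apply/integrableP; split; first by apply/measurable_EFinP; exact: measurable_funTS.
    exact: fK (@subsetT _ _) (@segment_compact _ _ _).
have le L : 0 < L -> (`|f x|%:E <= davg f x L)%E.
  move=> L0; rewrite /davg /iavg.
  have mb : measurable (ball x L : set (measurableTypeR R)) by exact: measurable_ball.
  have mu_b : leb (ball x L) = (L *+ 2)%:E by rewrite lebesgue_measure_ball// ltW.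
  have cK : leb.-integrable (ball x L) (EFin \o (fun=> f x)).
    apply/integrableP; split; first by apply/measurable_EFinP; exact: measurable_cst.
    by rewrite /= integral_cst//= mu_b ltry.
  have dK : leb.-integrable (ball x L) (EFin \o (fun t => f t - f x)).
    exact: integrableB (fK L L0) cK.
  have := le_normr_Rintegral mb dK.
  rewrite RintegralB//; last exact: fK.
  rewrite integral_ball_eq0// sub0r normrN Rintegral_cst// => h.
  rewrite mu_b -(@fineK _ (\int[_]_(_ in _) _)%E); last first.
    by apply: integrable_fin_num => //; exact: integrable_norm dK.
  rewrite inver mulrn_eq0/= gt_eqF// -EFinM lee_fin ler_pdivlMl ?mulrn_wgt0//.
  have -> : L *+ 2 * `|f x| = `|f x * fine (leb (ball x L))|.
    by rewrite mu_b/= normrM mulrC (ger0_norm (_ : 0 <= L *+ 2))// mulrn_wge0// ltW.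
  exact: h.
apply: (cvge_to_ge fx); near=> L; apply: le.
by near: L; exact: nbhs_right_gt.
Unshelve. all: by end_near. Qed.

(** * Integration by parts for primitives of integrable functions *)

Definition cumul f t : R := \int[leb]_s (f s * (s <= t)%R%:R).

Lemma integrableR_cut f t : integrableR f -> integrableR (fun s => f s * (s <= t)%R%:R).
Proof.
move=> fi; apply: (integrableR_le (g := fun s => `|f s|)); last 2 first.
- exact: integrable_norm fi.
- by move=> s; case: (s <= t)%R; rewrite ?mulr1// mulr0 normr0.
apply: measurable_funM; first exact: integrableR_measurable.
rewrite (_ : (fun s => _) = \1_`]-oo, t]%classic); first exact: measurable_indic.
apply/funext => s; rewrite indicE; congr (nat_of_bool _)%:R.
by rewrite mem_setE in_itv.
Qed.

Lemma cumul_bounded f t : integrableR f -> `|cumul f t| <= \int[leb]_s `|f s|.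
Proof.
move=> fi; apply: le_trans (le_normr_Rintegral measurableT (integrableR_cut t fi)) _.
apply: le_Rintegral => //; first exact: integrable_norm (integrableR_cut t fi).
  exact: integrable_norm fi.
by move=> s _; case: (s <= t)%R; rewrite ?mulr1// mulr0 normr0.
Qed.

(** The primitive of a nonnegative function is monotone, hence measurable;
    in general f is the difference of |f| + f and |f|. *)
Lemma measurable_cumul f : integrableR f -> measurable_fun setT (cumul f).
Proof.
move=> fi.
have ge0_case (p : R -> R) : integrableR p -> (forall s, 0 <= p s) ->
    measurable_fun setT (cumul p).
  move=> pi p0; apply: nondecreasing_measurable => // x y xy.
  apply: le_Rintegral => //; try exact: integrableR_cut.
  move=> s _; rewrite ler_wpM2l// ler_nat; case: leP => // sx.
  by rewrite (le_trans sx xy).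
have ni : integrableR (fun s => `|f s|) := integrable_norm fi.
have pi : integrableR (fun s => `|f s| + f s) := integrableRD ni fi.
have mp := ge0_case _ pi.
have := ge0_case _ ni.
move=> /(_ (fun=> normr_ge0 _)) mn.
rewrite (_ : cumul f = fun t => cumul (fun s => `|f s| + f s) t - cumul (fun s => `|f s|) t).
  apply: measurable_funB => //; apply: mp => s.
  by rewrite -lerBlDr sub0r -normrN ler_norm.
apply/funext => t; rewrite /cumul -RintegralB//; try exact: integrableR_cut.
by apply: eq_Rintegral => s _; ring.
Qed.

Lemma integrableR_mul_bounded f g C : integrableR f -> measurable_fun setT g ->
  (forall t, `|g t| <= C) -> integrableR (fun t => f t * g t).
Proof.
move=> fi mg gC; apply: (integrableR_le (g := fun t => C * `|f t|)).
- by apply: measurable_funM => //; exact: integrableR_measurable.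
- exact: integrableRZ (integrable_norm fi).
- by move=> t; rewrite normrM mulrC ler_wpM2r.
Qed.

Lemma integrableR_mul_cumul f g : integrableR f -> integrableR g ->
  integrableR (fun t => f t * cumul g t).
Proof.
move=> fi gi; apply: integrableR_mul_bounded fi (measurable_cumul gi) _ => t.
exact: cumul_bounded.
Qed.

Lemma ae_imply (P Q : R -> Prop) : (forall t, P t -> Q t) ->
  {ae leb, forall t, P t} -> {ae leb, forall t, Q t}.
Proof. exact: (@filterS _ _ (ae_filter_ringOfSetsType leb)). Qed.

Lemma ae_imply2 (P Q S : R -> Prop) : (forall t, P t -> Q t -> S t) ->
  {ae leb, forall t, P t} -> {ae leb, forall t, Q t} -> {ae leb, forall t, S t}.
Proof. exact: (@filterS2 _ _ (ae_filter_ringOfSetsType leb)). Qed.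

Lemma eq_Rintegral_ae f g : measurable_fun setT f -> measurable_fun setT g ->
  {ae leb, forall t, f t = g t} -> \int[leb]_t f t = \int[leb]_t g t.
Proof.
move=> mf mg fg; congr fine; apply: ae_eq_integral => //.
- by apply/measurable_EFinP; exact: mf.
- by apply/measurable_EFinP; exact: mg.
- by apply: ae_imply fg => t ->.
Qed.

Lemma measurable_mul_ge g (s : R) : measurable_fun setT g ->
  measurable_fun setT (fun t => g t * (s <= t)%R%:R).
Proof.
move=> mg; apply: measurable_funM => //.
rewrite (_ : (fun s => _) = \1_`[s, +oo[%classic); first exact: measurable_indic.
apply/funext => t; rewrite indicE; congr (nat_of_bool _)%:R.
by rewrite mem_setE in_itv/= andbT.
Qed.

(** The two indicators s <= t and t <= s overlap only at t = s, a null set. *)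
Lemma Rintegral_tail g (s : R) : integrableR g ->
  \int[leb]_t (g t * (s <= t)%R%:R) = \int[leb]_t g t - cumul g s.
Proof.
move=> gi; rewrite /cumul -RintegralB//; last exact: integrableR_cut.
apply: eq_Rintegral_ae.
- by apply: measurable_mul_ge; exact: integrableR_measurable.
- apply: measurable_funB; first exact: integrableR_measurable.
  exact: integrableR_measurable (integrableR_cut s gi).
- exists [set s]; split => //; first exact: lebesgue_measure_set1.
  move=> t /= h; apply: contrapT => ts; apply: h.
  move: (t : R) ts => {}t ts.
  by case: (ltgtP s t) ts => //= [_|_|->//] _; rewrite ?mulr1 ?mulr0 ?subr0 ?subrr.
Qed.

(** Integrate f s * g t over the half plane s <= t in both orders. *)
Lemma cumul_by_parts f g : integrableR f -> integrableR g ->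
  \int[leb]_t (f t * cumul g t) + \int[leb]_t (cumul f t * g t) =
  (\int[leb]_t f t) * (\int[leb]_t g t).
Proof.
move=> fi gi.
pose h (z : measurableTypeR R * measurableTypeR R) := f z.1 * (g z.2 * (z.1 <= z.2)%R%:R).
have mh : measurable_fun setT h.
  apply: measurable_funM.
    by apply: measurableT_comp => //; exact: integrableR_measurable.
  apply: measurable_funM.
    by apply: measurableT_comp => //; exact: integrableR_measurable.
  rewrite (_ : (fun s => _) = \1_[set z : measurableTypeR R * measurableTypeR R | (z.1 <= z.2)%R]).
    apply: measurable_indic.
    have := @measurable_fun_le _ (measurableTypeR R * measurableTypeR R)%type R
      setT fst snd measurableT.
    by rewrite setTI; apply.
  by apply/funext => z; rewrite indicE; congr (nat_of_bool _)%:R; rewrite mem_setE.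
have hi : (leb \x leb)%E.-integrable setT (EFin \o h).
  apply/integrable12ltyP; first exact/measurable_EFinP.
  pose K := \int[leb]_t `|g t|.
  have KE : (K%:E = \int[leb]_t `|g t|%:E)%E.
    by rewrite fineK//; exact: integrable_fin_num (integrable_norm gi).
  have fKi : integrableR (fun s => K * `|f s|) := integrableRZ K (integrable_norm fi).
  apply: le_lt_trans (integrable_lty measurableT fKi).
  apply: ge0_le_integral => //=.
  - by move=> s _; exact: integral_ge0.
  - apply: (measurable_fun_fubini_tonelli_F (fun z => `|(h z)%:E|%E)) => //=.
    by apply/measurable_EFinP; exact: measurableT_comp.
  - by apply/measurable_EFinP; exact: (integrableR_measurable fKi).
  move=> s _; rewrite mulrC EFinM KE -ge0_integralZl//=.
  - apply: ge0_le_integral => //=.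
    + apply/measurable_EFinP; apply: measurableT_comp => //.
      exact: measurable_funM (@measurable_cst _ _ _ _ _ (f s))
        (measurable_mul_ge s (integrableR_measurable gi)).
    + apply/measurable_EFinP; apply: measurable_funM => //.
      by apply: measurableT_comp => //; exact: integrableR_measurable.
    + move=> t _; rewrite -EFinM lee_fin /h/= !normrM ler_wpM2l//.
      by case: (s <= t)%R; rewrite ?normr1 ?mulr1// normr0 mulr0.
  - apply/measurable_EFinP; apply: measurableT_comp => //; exact: integrableR_measurable.
have := Fubini hi.
rewrite (_ : (fun x => _) = EFin \o (fun s => f s * (\int[leb]_t g t - cumul g s))); last first.
  apply/funext => s /=; rewrite -Rintegral_tail//.
  pose k t := g t * (s <= t)%R%:R.
  have ki : integrableR k.
    apply: (integrableR_le (g := fun t => `|g t|)); last 2 first.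
    - exact: integrable_norm.
    - by move=> t; rewrite /k; case: (s <= t)%R; rewrite ?mulr1// mulr0 normr0.
    by apply: measurable_mul_ge; exact: integrableR_measurable.
  rewrite -(RintegralZl _ measurableT ki) fineK//.
  by apply: integrable_fin_num => //; exact: (integrableRZ (f s) ki).
rewrite [in RHS](_ : (fun y => _) = EFin \o (fun t => g t * cumul f t)); last first.
  apply/funext => t /=; rewrite /cumul -(RintegralZl _ measurableT (integrableR_cut t fi)).
  rewrite /Rintegral fineK; first by apply: eq_integral => s _; rewrite /h/=; congr EFin; ring.
  by apply: integrable_fin_num => //; exact: (integrableRZ (g t) (integrableR_cut t fi)).
move=> /(congr1 fine) E.
have {}E : \int[leb]_t (f t * (\int[leb]_t g t - cumul g t)) = \int[leb]_t (g t * cumul f t).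
  exact: E.
have fgi := integrableR_mul_cumul fi gi.
have : \int[leb]_t (f t * (\int[leb]_t g t - cumul g t)) =
    (\int[leb]_t g t) * (\int[leb]_t f t) - \int[leb]_t (f t * cumul g t).
  rewrite -RintegralZl// -RintegralB//; last exact: integrableRZ.
  by apply: eq_Rintegral => t _; ring.
rewrite E => E2.
rewrite [X in _ + X](_ : _ = \int[leb]_t (g t * cumul f t)); last first.
  by apply: eq_Rintegral => t _; rewrite mulrC.
by rewrite E2; ring.
Qed.

(** * Weak derivatives of square integrable functions *)

Lemma integrableR_ae f g : measurable_fun setT f -> integrableR g ->
  {ae leb, forall t, f t = g t} -> integrableR f.
Proof.
move=> mf /integrableP[mg gi] fg; apply/integrableP; split.
  by apply/measurable_EFinP; exact: mf.
apply: le_lt_trans gi; rewrite le_eqVlt; apply/orP; left; apply/eqP.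
apply: ae_eq_integral => //.
- by apply: measurableT_comp => //; apply/measurable_EFinP; exact: mf.
- exact: measurableT_comp.
- by apply: ae_imply fg => t /= ->.
Qed.

Local Notation L2R f := (f%R \in Lfun leb 2%:E).

Lemma L2_measurable f : L2R f -> measurable_fun setT f.
Proof. by move=> /sub_Lfun_mfun; rewrite inE. Qed.

Lemma L2_sqr_integrableR f : L2R f -> integrableR (fun t => f t ^+ 2).
Proof. exact: Lfun2_integrable_sqr. Qed.

Lemma L2_mul_integrableR f g : L2R f -> L2R g -> integrableR (fun t => f t * g t).
Proof. by move=> fL gL; apply/Lfun1_integrable; exact: Lfun2_mul_Lfun1. Qed.

Lemma L2I f : measurable_fun setT f -> integrableR (fun t => f t ^+ 2) -> L2R f.
Proof.
move=> mf fi; rewrite inE; apply/andP; split; rewrite inE/=; first exact: mf.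
rewrite /finite_norm unlock; apply: poweR_lty.
rewrite [ltLHS](_ : _ = \int[leb]_t (f t ^+ 2)%:E)%E; first exact: integrable_lty fi.
apply: eq_integral => t _ /=.
by rewrite powR_mulrn// real_normK// num_real.
Qed.

(** One has |f| <= 1 + f^2, and compact sets have finite measure. *)
Lemma L2_locally_integrable f : L2R f -> locally_integrable setT f.
Proof.
move=> fL; split; [exact: L2_measurable|exact: openT|move=> K _ cK].
have mK : measurable (K : set (measurableTypeR R)) by exact: compact_measurable.
have Ki : leb.-integrable K (EFin \o (fun=> 1 : R)).
  apply/integrableP; split; first by apply/measurable_EFinP; exact: measurable_cst.
  by rewrite /= integral_cst//= normr1 mul1e; exact: compact_finite_measure.
have fi : leb.-integrable K (EFin \o (fun t => f t ^+ 2)).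
  by apply: integrableS (L2_sqr_integrableR fL) => //.
have := integrable_lty mK (integrableD mK Ki fi).
apply: le_lt_trans; apply: ge0_le_integral => //=.
- apply/measurable_EFinP; apply: measurableT_comp => //.
  by apply: measurable_funTS; exact: L2_measurable.
- exact: measurable_int (integrableD mK Ki fi).
move=> t _; rewrite -EFinD lee_fin -[X in _ + X]real_normK ?num_real//.
have := sqr_ge0 (`|f t| - 1); have := normr_ge0 (f t); nra.
Qed.

Lemma L2_compact_support f (M : R) : continuous f ->
  (forall t, M < `|t| -> f t = 0) -> L2R f.
Proof.
move=> cf fM; apply: L2I; first exact: continuous_measurable_fun.
apply: (@compact_support_integrable _ M) => [t|t /fM->]; last by rewrite expr0n.
by apply: cvgM; exact: cf.
Qed.

Lemma C1c_L2 phi : C1c phi -> L2R phi.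
Proof.
move=> cphi; have [M h] := C1c_support cphi.
apply: (@L2_compact_support _ M); last by move=> t /h[].
exact: C1_deriv_continuous (C1c_deriv cphi).
Qed.

Lemma C1c_deriv_L2 phi : C1c phi -> L2R (derive1 phi).
Proof.
move=> cphi; have [M h] := C1c_support cphi.
by apply: (@L2_compact_support _ M); [exact: (C1c_deriv cphi).2|move=> t /h[]].
Qed.

Lemma C1_deriv_cumul psi : C1c psi -> C1_deriv (cumul psi) psi.
Proof.
move=> cpsi; have cont := C1_deriv_continuous (C1c_deriv cpsi).
split=> // x.
have -> : cumul psi = fun x => \int[leb]_(t in `]-oo, x]) psi t.
  apply/funext => y; rewrite /cumul [RHS]Rintegral_mkcond; apply: eq_Rintegral => t _.
  by rewrite patchE mem_setE in_itv/=; case: (t <= y)%R; rewrite ?mulr1 ?mulr0.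
have [|||dF <-] := @continuous_FTC1 _ psi -oo%O x (x + 1) _ _ _ (cont x).
- by rewrite ltrDl.
- exact: integrableS (C1c_integrableR cpsi).
- exact: ltNyr.
by rewrite derive1E; exact: derivableP.
Qed.

(** After multiplication by chi the weak derivative may be tested against
    any C^1 function Psi, because chi * Psi is again a test function. *)
Lemma cutoff_weak_derivative u v chi Psi dPsi : L2R u -> L2R v ->
  weak_derivative u v ->
  C1c chi -> C1_deriv Psi dPsi ->
  integrableR (fun t => u t * (chi t * dPsi t)) /\
  integrableR (fun t => (chi t * v t + derive1 chi t * u t) * Psi t) /\
  \int[leb]_t (u t * (chi t * dPsi t)) =
  - \int[leb]_t ((chi t * v t + derive1 chi t * u t) * Psi t).
Proof.
move=> uL vL uv cchi cPsi; have [M h] := C1c_support cchi.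
have Psic := C1_deriv_continuous cPsi.
have cc := C1c_deriv cchi; have chic := C1_deriv_continuous cc.
have L1 : L2R (fun t => chi t * dPsi t).
  apply: (@L2_compact_support _ M) => [t|t /h[->] _]; last by rewrite mul0r.
  by apply: cvgM; [exact: chic|exact: cPsi.2].
have L2 : L2R (fun t => chi t * Psi t).
  apply: (@L2_compact_support _ M) => [t|t /h[->] _]; last by rewrite mul0r.
  by apply: cvgM; [exact: chic|exact: Psic].
have L3 : L2R (fun t => derive1 chi t * Psi t).
  apply: (@L2_compact_support _ M) => [t|t /h[_ ->]]; last by rewrite mul0r.
  by apply: cvgM; [exact: cc.2|exact: Psic].
have I1 := L2_mul_integrableR uL L1.
have I2 := L2_mul_integrableR vL L2.
have I3 := L2_mul_integrableR uL L3.
have E : (fun t => (chi t * v t + derive1 chi t * u t) * Psi t) =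
    (fun t => v t * (chi t * Psi t) + u t * (derive1 chi t * Psi t)).
  by apply/funext => t; ring.
rewrite E; split=> //; split; first exact: integrableRD.
have := uv _ (C1cM cchi cPsi).
rewrite (C1_deriv_derive1 (C1_derivM cc cPsi)).
under eq_Rintegral do rewrite mulrDr.
rewrite RintegralD// => h1.
rewrite RintegralD// -[X in _ = - (X + _)]opprK -h1; ring.
Qed.

Lemma integrableR_cutoff_derivative u v chi : L2R u -> L2R v -> C1c chi ->
  integrableR (fun t => chi t * v t + derive1 chi t * u t).
Proof.
move=> uL vL cchi; apply: integrableRD; apply: L2_mul_integrableR => //.
- exact: C1c_L2.
- exact: C1c_deriv_L2.
Qed.

(** Test with the constant function 1. *)
Lemma cutoff_derivative_integral0 u v chi : L2R u -> L2R v -> weak_derivative u v ->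
  C1c chi -> \int[leb]_t (chi t * v t + derive1 chi t * u t) = 0.
Proof.
move=> uL vL uv cchi.
have [_ [_]] := cutoff_weak_derivative uL vL uv cchi (C1_deriv_cst 1).
under eq_Rintegral do rewrite mulr0 mulr0.
under [X in _ = - X]eq_Rintegral do rewrite mulr1.
by rewrite Rintegral_cst// mul0r => /esym/eqP; rewrite oppr_eq0 => /eqP.
Qed.

(** A primitive of the test function psi is an admissible Psi in
    [cutoff_weak_derivative]; integrating by parts moves the primitive onto
    the weak derivative of chi u, whose total integral is 0.  So chi u and
    the primitive of its weak derivative have the same integral against
    every psi. *)
Lemma cutoff_eq_cumul u v chi : L2R u -> L2R v -> weak_derivative u v ->
  C1c chi ->
  {ae leb, forall t, chi t * u t = cumul (fun s => chi s * v s + derive1 chi s * u s) t}.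
Proof.
move=> uL vL uv cchi.
set w := fun s => chi s * v s + derive1 chi s * u s.
have wi : integrableR w := integrableR_cutoff_derivative uL vL cchi.
have yi : integrableR (fun t => chi t * u t) := L2_mul_integrableR (C1c_L2 cchi) uL.
suff : {ae leb, forall t, chi t * u t - cumul w t = 0}.
  by apply: ae_imply => t /subr0_eq.
apply: fundamental_lemma.
  apply: locally_integrableB; first exact: open_integrable_locally openT yi.
  split; [exact: measurable_cumul|exact: openT|move=> K _ cK].
  have mK : measurable (K : set (measurableTypeR R)) by exact: compact_measurable.
  apply: (@le_lt_trans _ _ (\int[leb]_(x in K) (\int[leb]_s `|w s|)%:E)%E).
    apply: ge0_le_integral => //=.
    - apply/measurable_EFinP; apply: measurableT_comp => //.
      by apply: measurable_funTS; exact: measurable_cumul.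
    - by move=> t _; rewrite lee_fin cumul_bounded.
  rewrite integral_cst//= lte_mul_pinfty ?lee_fin ?Rintegral_ge0//.
  exact: compact_finite_measure.
move=> psi cpsi.
have pi := C1c_integrableR cpsi.
have [I1 [_ E]] := cutoff_weak_derivative uL vL uv cchi (C1_deriv_cumul cpsi).
have := cumul_by_parts wi pi.
rewrite (cutoff_derivative_integral0 uL vL uv cchi) mul0r.
have -> : \int[leb]_t (w t * cumul psi t) = - \int[leb]_t (u t * (chi t * psi t)).
  by rewrite E opprK.
move/eqP; rewrite addrC subr_eq0 => /eqP E2.
under eq_Rintegral do rewrite mulrBl.
have I2 : integrableR (fun t => cumul w t * psi t).
  under eq_fun do rewrite mulrC.
  exact: integrableR_mul_cumul.
have E3 : (fun t => chi t * u t * psi t) = (fun t => u t * (chi t * psi t)).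
  by apply/funext => t; ring.
by rewrite RintegralB// E3// E2 subrr.
Qed.

(** This is the vanishing of the integral of ((chi u) (psi u))': both factors
    are primitives of functions with zero integral.  Writing the drift as a
    product chi psi of test functions spares a second cut-off. *)
Lemma weak_derivative_sqr_drift u v chi psi : L2R u -> L2R v ->
  weak_derivative u v ->
  C1c chi -> C1c psi ->
  integrableR (fun t => 2 * (chi t * psi t) * (u t * v t) +
    (derive1 chi t * psi t + chi t * derive1 psi t) * u t ^+ 2) /\
  \int[leb]_t (2 * (chi t * psi t) * (u t * v t) +
    (derive1 chi t * psi t + chi t * derive1 psi t) * u t ^+ 2) = 0.
Proof.
move=> uL vL uv cchi cpsi.
have i1 := integrableR_cutoff_derivative uL vL cchi.
have i2 := integrableR_cutoff_derivative uL vL cpsi.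
have := cumul_by_parts i1 i2.
rewrite (cutoff_derivative_integral0 uL vL uv cchi) mul0r.
set w1 := fun t => chi t * v t + derive1 chi t * u t.
set w2 := fun t => psi t * v t + derive1 psi t * u t.
have a1 := cutoff_eq_cumul uL vL uv cchi.
have a2 := cutoff_eq_cumul uL vL uv cpsi.
have mu := L2_measurable uL.
have mchi := L2_measurable (C1c_L2 cchi).
have mpsi := L2_measurable (C1c_L2 cpsi).
have j1 := integrableR_mul_cumul i1 i2.
have j2 := integrableR_mul_cumul i2 i1.
have mw1 := integrableR_measurable i1.
have mw2 := integrableR_measurable i2.
rewrite -/w1 -/w2 in i1 i2 a1 a2 j1 j2 mw1 mw2 *.
have [b1 e1] : integrableR (fun t => w1 t * (psi t * u t)) /\
  \int[leb]_t (w1 t * cumul w2 t) = \int[leb]_t (w1 t * (psi t * u t)).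
  have m : measurable_fun setT (fun t => w1 t * (psi t * u t)) by do 2?apply: measurable_funM.
  have ae : {ae leb, forall t, w1 t * (psi t * u t) = w1 t * cumul w2 t}.
    by apply: ae_imply a2 => t ->.
  split; first exact: integrableR_ae m j1 ae.
  by apply/esym/eq_Rintegral_ae => //; exact: integrableR_measurable j1.
have [b2 e2] : integrableR (fun t => w2 t * (chi t * u t)) /\
  \int[leb]_t (cumul w1 t * w2 t) = \int[leb]_t (w2 t * (chi t * u t)).
  have m : measurable_fun setT (fun t => w2 t * (chi t * u t)) by do 2?apply: measurable_funM.
  have ae : {ae leb, forall t, w2 t * (chi t * u t) = w2 t * cumul w1 t}.
    by apply: ae_imply a1 => t ->.
  split; first exact: integrableR_ae m j2 ae.
  under eq_Rintegral do rewrite mulrC.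
  by apply/esym/eq_Rintegral_ae => //; exact: integrableR_measurable j2.
rewrite e1 e2 -RintegralD//.
have -> : (fun t => 2 * (chi t * psi t) * (u t * v t) +
    (derive1 chi t * psi t + chi t * derive1 psi t) * u t ^+ 2) =
  (fun t => w1 t * (psi t * u t) + w2 t * (chi t * u t)).
  by apply/funext => t; rewrite /w1 /w2; ring.
by split=> //; exact: integrableRD.
Qed.

(** * Lower bound of the energy far to the left *)

(** The drift is the logarithmic derivative - k (t - c) of the gaussian of a
    harmonic well of slope k, cut off at distance L by the square of the
    bump: one bump for each factor of [weak_derivative_sqr_drift]. *)
Definition drift_factor k c L t : R := bump c L t * (- k * (t - c)).

Lemma C1_deriv_linear k c : C1_deriv (fun t => k * (t - c)) (fun=> k).
Proof.
have := C1_derivM (C1_deriv_cst k) (C1_derivD C1_deriv_id (C1_deriv_cst (- c))).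
by congr C1_deriv; apply/funext => t; ring.
Qed.

Lemma C1c_drift_factor k c L : 0 < L -> C1c (drift_factor k c L).
Proof. by move=> L0; exact: C1cM (C1c_bump c L0) (C1_deriv_linear (- k) c). Qed.

Lemma derive1_bump c L : 0 < L -> derive1 (bump c L) = dbump c L.
Proof. by move=> L0; exact: C1_deriv_derive1 (C1_deriv_bump c (lt0r_neq0 L0)). Qed.

Lemma derive1_drift_factor k c L t : 0 < L ->
  derive1 (drift_factor k c L) t = dbump c L t * (- k * (t - c)) + bump c L t * - k.
Proof.
move=> L0.
by rewrite (C1_deriv_derive1 (C1_derivM (C1_deriv_bump c (lt0r_neq0 L0)) (C1_deriv_linear (- k) c))).
Qed.

Definition drift k c L t : R := bump c L t * drift_factor k c L t.

Definition ddrift k c L t : R :=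
  derive1 (bump c L) t * drift_factor k c L t + bump c L t * derive1 (drift_factor k c L) t.

Lemma drift_outside k c L t : 0 < L -> L <= `|t - c| ->
  drift k c L t = 0 /\ ddrift k c L t = 0.
Proof.
by move=> L0 Lt; rewrite /drift /ddrift /drift_factor bump_eq0// !mul0r mulr0 addr0.
Qed.

(** Put y = ((t - c) / L)^2.  Inside the support the claim follows from
    (k L y - 6 / L)^2 >= 0 and Bernoulli-type bounds on the powers of 1 - y;
    outside, where the drift vanishes, from (k L - 6 / L)^2 >= 0. *)
Lemma drift_riccati k c L t : 0 < k -> 0 < L ->
  k - 36 / L ^+ 2 + drift k c L t ^+ 2 + ddrift k c L t <= (k * (t - c)) ^+ 2.
Proof.
move=> k0 L0; rewrite /drift /ddrift derive1_bump// derive1_drift_factor// /drift_factor /dbump /bump.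
have Ln0 : L != 0 by rewrite gt_eqF.
pose r := (t - c) / L; have tr : t - c = L * r by rewrite /r; field.
rewrite -/r tr; set m := Num.max 0 (1 - r ^+ 2).
pose B := 6 / L.
have -> : 36 / L ^+ 2 = B ^+ 2 by rewrite /B; field.
(* The square to complete is (A y - B)^2, with A = k L and B = 6 / L. *)
have kE : k * L * B = 6 * k by rewrite /B; field.
have -> : k - B ^+ 2 + (m ^+ 2 * (m ^+ 2 * (- k * (L * r)))) ^+ 2 +
  (- (2 * (L * r) / L ^+ 2) * (2 * m) * (m ^+ 2 * (- k * (L * r))) +
   m ^+ 2 * (- (2 * (L * r) / L ^+ 2) * (2 * m) * (- k * (L * r)) + m ^+ 2 * - k)) =
  k - B ^+ 2 + (k * L) ^+ 2 * r ^+ 2 * m ^+ 8 - k * m ^+ 4 + 8 * k * r ^+ 2 * m ^+ 3.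
  by field.
have -> : (k * (L * r)) ^+ 2 = (k * L) ^+ 2 * r ^+ 2 by ring.
rewrite {tr}/m; set y := r ^+ 2; have y0 : 0 <= y by rewrite sqr_ge0.
move: kE; set A := k * L => kE.
have [y1|y1] := leP 1 y.
  rewrite max_l ?subr_le0// !expr0n/= !mulr0 subr0 !addr0.
  have := sqr_ge0 (A - B); have : A ^+ 2 * 1 <= A ^+ 2 * y by rewrite ler_wpM2l ?sqr_ge0.
  nra.
rewrite max_r ?subr_ge0 ?(ltW y1)//.
have m0 : 0 <= 1 - y by lra.
have m1 : 1 - y <= 1 by lra.
have h8 : (1 - y) ^+ 8 <= 1 - y by rewrite -[leRHS]expr1 ler_wiXn2l.
have h3 : (1 - y) ^+ 3 <= 1 by rewrite exprn_ile1.
have h4 : 1 - 4 * y <= (1 - y) ^+ 4.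
  have -> : (1 - y) ^+ 4 = 1 - 4 * y + y ^+ 2 * (6 - 4 * y + y ^+ 2) by ring.
  by rewrite lerDl mulr_ge0 ?sqr_ge0//; have := sqr_ge0 y; lra.
have q : 0 <= (A * y - B) ^+ 2 by rewrite sqr_ge0.
have a8 : A ^+ 2 * y * (1 - y) ^+ 8 <= A ^+ 2 * y * (1 - y).
  by rewrite ler_wpM2l// mulr_ge0 ?sqr_ge0.
have a4 : k * (1 - 4 * y) <= k * (1 - y) ^+ 4 by rewrite ler_wpM2l// ltW.
have a3 : 8 * k * y * (1 - y) ^+ 3 <= 8 * k * y * 1.
  by rewrite ler_wpM2l// mulr_ge0// mulr_ge0// ltW.
have : (A * y - B) ^+ 2 = A ^+ 2 * y * y - 2 * (A * B) * y + B ^+ 2 by ring.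
rewrite kE; move=> qE; rewrite qE in q.
have : A ^+ 2 * y * (1 - y) = A ^+ 2 * y - A ^+ 2 * y * y by ring.
lra.
Qed.

(** The drifts of the two wells, cut off at distance x, live on opposite
    sides of 0, because x / b >= x; on each side the potential is that of
    the corresponding well. *)
Lemma V_riccati b x t : 0 < b -> b <= 1 -> 0 < x ->
  b - 36 / x ^+ 2 + (drift b (- (x / b)) x t + drift 1 x x t) ^+ 2 +
  (ddrift b (- (x / b)) x t + ddrift 1 x x t) <= V (- b) (- x) t.
Proof.
move=> b0 b1 x0; rewrite /V.
have xb : x <= x / b by rewrite ler_pdivlMr// ler_piMr// ltW.
case: ltP => t0.
  have [-> ->] : drift 1 x x t = 0 /\ ddrift 1 x x t = 0.
    by apply: drift_outside => //; rewrite ler0_norm; lra.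
  rewrite !addr0; apply: le_trans (drift_riccati (- (x / b)) t b0 x0) _.
  have -> : b * (t - - (x / b)) = b * t + x by rewrite mulrDr opprK mulrCA divff ?gt_eqF// mulr1.
  by rewrite le_eqVlt; apply/orP; left; apply/eqP; ring.
have [-> ->] : drift b (- (x / b)) x t = 0 /\ ddrift b (- (x / b)) x t = 0.
  by apply: drift_outside => //; rewrite ger0_norm; lra.
rewrite !add0r; have := drift_riccati x t ltr01 x0.
rewrite mul1r (addrC (- x)).
lra.
Qed.

Lemma measurable_V a xi : measurable_fun setT (V a xi : R -> R).
Proof.
apply: measurable_fun_ifT; first exact: measurable_fun_ltr.
- by apply: measurable_funX; apply: measurable_funD => //; apply: measurable_funM.
- by apply: measurable_funX; apply: measurable_funD.
Qed.

Lemma V_ge0 a xi t : 0 <= V a xi t.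
Proof. by rewrite /V; case: ifP => _; rewrite sqr_ge0. Qed.

Lemma V_le a xi t : V a xi t <= 2 * xi ^+ 2 + 2 * (1 + a ^+ 2) * t ^+ 2.
Proof.
rewrite /V; case: ifP => _.
  have := sqr_ge0 (xi - a * t); have := sqr_ge0 t.
  have -> : (xi + a * t) ^+ 2 = 2 * xi ^+ 2 + 2 * a ^+ 2 * t ^+ 2 - (xi - a * t) ^+ 2 by ring.
  lra.
have := sqr_ge0 (xi - t); have : 0 <= a ^+ 2 * t ^+ 2 by rewrite mulr_ge0 ?sqr_ge0.
have -> : (xi + t) ^+ 2 = 2 * xi ^+ 2 + 2 * t ^+ 2 - (xi - t) ^+ 2 by ring.
lra.
Qed.

Lemma integrableR_V u a xi : L2R u -> L2R (fun t => t * u t) ->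
  integrableR (fun t => V a xi t * u t ^+ 2).
Proof.
move=> uL tuL.
apply: (integrableR_le (g := fun t =>
  2 * xi ^+ 2 * u t ^+ 2 + 2 * (1 + a ^+ 2) * (t * u t) ^+ 2)).
- apply: measurable_funM; first exact: measurable_V.
  by apply: measurable_funX; exact: L2_measurable.
- by apply: integrableRD; apply: integrableRZ; exact: L2_sqr_integrableR.
- move=> t; rewrite ger0_norm; last by apply: mulr_ge0; [exact: V_ge0|exact: sqr_ge0].
  apply: le_trans (ler_wpM2r (sqr_ge0 _) (V_le _ _ _)) _.
  by rewrite le_eqVlt; apply/orP; left; apply/eqP; ring.
Qed.

(** Expand (v - g u)^2 >= 0, where g is the sum of the two drifts, and
    integrate: the cross terms cancel by [weak_derivative_sqr_drift]. *)
Lemma energy_ge_far u v b x : 0 < b -> b <= 1 -> 0 < x ->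
  L2R u -> L2R v -> L2R (fun t => t * u t) -> weak_derivative u v ->
  (b - 36 / x ^+ 2) * \int[leb]_t (u t ^+ 2) <=
  \int[leb]_t (v t ^+ 2 + V (- b) (- x) t * u t ^+ 2).
Proof.
move=> b0 b1 x0 uL vL tuL uv.
have [i1 e1] := weak_derivative_sqr_drift uL vL uv (C1c_bump (- (x / b)) x0)
  (C1c_drift_factor b (- (x / b)) x0).
have [i2 e2] := weak_derivative_sqr_drift uL vL uv (C1c_bump x x0) (C1c_drift_factor 1 x x0).
have u2 := integrableRZ (b - 36 / x ^+ 2) (L2_sqr_integrableR uL).
have v2 := L2_sqr_integrableR vL.
have Vu := integrableR_V (- b) (- x) uL tuL.
rewrite -[leLHS]addr0 -{1}e1 -[leLHS]addr0 -[X in _ + X <= _]e2.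
rewrite -RintegralZl; [|by []|exact: L2_sqr_integrableR].
rewrite -RintegralD// -RintegralD//; last exact: integrableRD.
apply: le_Rintegral => //.
- by apply: integrableRD => //; exact: integrableRD.
- exact: integrableRD.
move=> t _; have := V_riccati t b0 b1 x0.
have := sqr_ge0 (v t - (drift b (- (x / b)) x t + drift 1 x x t) * u t).
rewrite -/(drift b _ x t) -/(ddrift b _ x t) -/(drift 1 x x t) -/(ddrift 1 x x t).
set g1 := drift b _ _ _; set g2 := drift 1 _ _ _.
set d1 := ddrift b _ _ _; set d2 := ddrift 1 _ _ _ => /= h1 h2.
have := ler_wpM2r (sqr_ge0 (u t)) h2.
rewrite -subr_ge0 => h3; rewrite -subr_ge0.
apply: le_trans (addr_ge0 h1 h3) _.
by rewrite le_eqVlt; apply/orP; left; apply/eqP; ring.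
Qed.

(** * The quadratic form and the ground energy *)

(** The difference of two weak derivatives is orthogonal to all test
    functions. *)
Lemma weak_derivative_unique (f v1 v2 : R -> R) : L2R v1 -> L2R v2 ->
  weak_derivative f v1 -> weak_derivative f v2 ->
  {ae leb, forall t, v1 t = v2 t}.
Proof.
move=> v1L v2L fv1 fv2.
suff : {ae leb, forall t, v1 t - v2 t = 0} by apply: ae_imply => t /subr0_eq.
apply: fundamental_lemma.
  by apply: locally_integrableB; exact: L2_locally_integrable.
move=> phi cphi; have pL := C1c_L2 cphi.
under eq_Rintegral do rewrite mulrBl.
rewrite RintegralB//; [|exact: L2_mul_integrableR..].
by apply/eqP; rewrite subr_eq0 -eqr_opp -fv1// -fv2.
Qed.

Lemma Re_mul_real (t : R) (z : R[i]) :
  complex.Re (t%:C%C * z) = t * complex.Re z.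
Proof. by case: z => x y /=; rewrite mul0r subr0. Qed.

Lemma Im_mul_real (t : R) (z : R[i]) :
  complex.Im (t%:C%C * z) = t * complex.Im z.
Proof. by case: z => x y /=; rewrite mul0r addr0. Qed.

Lemma sqnormc_ge0 (z : R[i]) : 0 <= sqnormc z.
Proof. by rewrite addr_ge0 ?sqr_ge0. Qed.

Lemma sqnormc_eq0 (z : R[i]) : sqnormc z = 0 -> z = 0.
Proof.
case: z => x y /eqP; rewrite /sqnormc /= paddr_eq0 ?sqr_ge0// !sqrf_eq0.
by move=> /andP[/eqP-> /eqP->].
Qed.

Lemma integrableR_sqnormc (u : R -> R[i]) : L2 u -> integrableR (fun t => sqnormc (u t)).
Proof. by move=> [rL iL]; apply: integrableRD; exact: L2_sqr_integrableR. Qed.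

Lemma integrableR_energy (u v : R -> R[i]) a xi : B1 u -> L2 v ->
  integrableR (fun t => sqnormc (v t) + V a xi t * sqnormc (u t)).
Proof.
move=> [[ruL iuL] _ [rtL itL]] vL.
apply: integrableRD; first exact: integrableR_sqnormc.
under eq_fun do rewrite mulrDr.
apply: integrableRD; apply: integrableR_V => //.
- by under eq_fun do rewrite -Re_mul_real.
- by under eq_fun do rewrite -Im_mul_real.
Qed.

Lemma weak_derivP (u : R -> R[i]) : B1 u -> L2_derivative u (weak_deriv u).
Proof. by move=> [_ [v uv] _]; exact: (xgetPex (fun=> 0) (ex_intro _ v uv)). Qed.

(** The energy is insensitive to the choice made by [weak_deriv]. *)
Lemma q_eq_weak_derivative (u v : R -> R[i]) a xi : B1 u -> L2_derivative u v ->
  q a xi u = \int[leb]_t (sqnormc (v t) + V a xi t * sqnormc (u t)).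
Proof.
move=> uB uv; have [wL wr wi] := weak_derivP uB; have [vL vr vi] := uv.
have er := weak_derivative_unique wL.1 vL.1 wr vr.
have ei := weak_derivative_unique wL.2 vL.2 wi vi.
apply: eq_Rintegral_ae.
- exact: integrableR_measurable (integrableR_energy a xi uB wL).
- exact: integrableR_measurable (integrableR_energy a xi uB vL).
by apply: ae_imply2 er ei => t hr hi; rewrite /sqnormc hr hi.
Qed.

(** Nonzero as an element of L^2. *)
Definition nonnull (u : R -> R[i]) : Prop := ~ {ae leb, forall t, u t = 0}.

Lemma sqnormL2_gt0 (u : R -> R[i]) : B1 u -> nonnull u -> 0 < sqnormL2 u.
Proof.
move=> [uL _ _] u0; rewrite lt_neqAle Rintegral_ge0 ?andbT; last first.
  by move=> t _; exact: sqnormc_ge0.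
apply/negP => /eqP/esym I0; apply: u0.
have ui := integrableR_sqnormc uL.
suff : {ae leb, forall t, sqnormc (u t) = 0} by apply: ae_imply => t; exact: sqnormc_eq0.
have /(ae_eq_integral_abs leb measurableT) : measurable_fun setT (EFin \o (fun t => sqnormc (u t))).
  exact: measurable_int ui.
move=> [+ _] => /(_ _)/wrap[].
  under eq_integral => t _ do rewrite /= ger0_norm ?sqnormc_ge0//.
  rewrite -(@fineK _ (\int[_]_(_ in _) _)%E); first by congr EFin.
  exact: integrable_fin_num ui.
by apply: ae_imply => t /(_ Logic.I) [].
Qed.

Lemma q_ge0 (a xi : R) (u : R -> R[i]) : 0 <= q a xi u.
Proof.
apply: Rintegral_ge0 => t _.
by rewrite addr_ge0 ?sqnormc_ge0// mulr_ge0 ?sqnormc_ge0 ?V_ge0.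
Qed.

Lemma mu_le (a xi : R) (u : R -> R[i]) : B1 u -> nonnull u ->
  mu a xi <= q a xi u / sqnormL2 u.
Proof.
move=> uB u0; apply: ge_inf; last by exists u.
exists 0 => _ [w [wB w0] <-].
by rewrite divr_ge0 ?q_ge0// ltW// sqnormL2_gt0.
Qed.

(** The function u0 witnesses that the set of Rayleigh quotients is
    nonempty, without which its infimum has no meaning. *)
Lemma mu_ge (a xi E : R) (u0 : R -> R[i]) : B1 u0 -> nonnull u0 ->
  (forall u, B1 u -> nonnull u -> E * sqnormL2 u <= q a xi u) -> E <= mu a xi.
Proof.
move=> u0B u0n h; apply: lb_le_inf; first by exists (q a xi u0 / sqnormL2 u0); exists u0.
by move=> _ [u [uB un] <-]; rewrite ler_pdivlMr ?sqnormL2_gt0// h.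
Qed.

Lemma mu_ge_far (b x : R) (u0 : R -> R[i]) : B1 u0 -> nonnull u0 ->
  0 < b -> b <= 1 -> 0 < x -> b - 36 / x ^+ 2 <= mu (- b) (- x).
Proof.
move=> u0B u0n b0 b1 x0; apply: mu_ge u0B u0n _ => u uB _.
have [wL wr wi] := weak_derivP uB; have [[ruL iuL] _ [rtL itL]] := uB.
have rtL' : L2R (fun t => t * complex.Re (u t)) by under eq_fun do rewrite -Re_mul_real.
have itL' : L2R (fun t => t * complex.Im (u t)) by under eq_fun do rewrite -Im_mul_real.
have -> : sqnormL2 u =
  \int[leb]_t (complex.Re (u t) ^+ 2) + \int[leb]_t (complex.Im (u t) ^+ 2).
  by rewrite -RintegralD//; exact: L2_sqr_integrableR.
rewrite mulrDr; apply: le_trans (lerD (energy_ge_far b0 b1 x0 ruL wL.1 rtL' wr)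
  (energy_ge_far b0 b1 x0 iuL wL.2 itL' wi)) _.
rewrite -RintegralD//; last 2 first.
- by apply: integrableRD; [apply: L2_sqr_integrableR wL.1|exact: integrableR_V].
- by apply: integrableRD; [apply: L2_sqr_integrableR wL.2|exact: integrableR_V].
by rewrite le_eqVlt; apply/orP; left; apply/eqP; apply: eq_Rintegral => t _; rewrite /sqnormc; ring.
Qed.

Lemma mu_ge_sqr (b xi : R) (u0 : R -> R[i]) : B1 u0 -> nonnull u0 ->
  0 <= b -> 0 <= xi -> xi ^+ 2 <= mu (- b) xi.
Proof.
move=> u0B u0n b0 xi0; apply: mu_ge u0B u0n _ => u uB _.
have [wL _ _] := weak_derivP uB; have [uL _ _] := uB.
rewrite /sqnormL2 -RintegralZl//; last exact: integrableR_sqnormc.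
apply: le_Rintegral => //.
- exact: integrableRZ (integrableR_sqnormc uL).
- exact: integrableR_energy.
move=> t _; rewrite -[leLHS]add0r lerD ?sqnormc_ge0// ler_wpM2r ?sqnormc_ge0//.
rewrite /V; case: ltP => t0; rewrite lerXn2r ?nnegrE//; try lra.
- have : 0 <= - b * t by rewrite mulNr oppr_ge0 mulr_ge0_le0// ltW.
  lra.
- have : 0 <= - b * t by rewrite mulNr oppr_ge0 mulr_ge0_le0// ltW.
  lra.
Qed.

(** With s = a t or s = t, according to the sign of t, (xi' + s)^2 is at
    most (1 + d) (xi + s)^2 + (1 + 1 / d) (xi - xi')^2, and d = |xi - xi'| makes
    the last term equal to (1 + d) d. *)
Lemma mu_perturb (a xi xi' : R) (u0 : R -> R[i]) : B1 u0 -> nonnull u0 -> xi != xi' ->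
  mu a xi' <= (1 + `|xi - xi'|) * (mu a xi + `|xi - xi'|).
Proof.
move=> u0B u0n xx; set d := `|xi - xi'|.
have d0 : 0 < d by rewrite normr_gt0 subr_eq0.
have d1 : 0 < 1 + d by lra.
rewrite -ler_pdivrMl// -lerBlDr; apply: mu_ge u0B u0n _ => u uB un.
have [wL _ _] := weak_derivP uB; have [uL _ _] := uB.
have n0 := sqnormL2_gt0 uB un.
have : mu a xi' * sqnormL2 u <= q a xi' u by rewrite -ler_pdivlMr// mu_le.
have : q a xi' u <= (1 + d) * (q a xi u + d * sqnormL2 u).
  rewrite /sqnormL2 -RintegralZl//; last exact: integrableR_sqnormc.
  have ei := integrableR_energy a xi uB wL.
  have ui := integrableRZ d (integrableR_sqnormc uL).
  rewrite /q -RintegralD// -RintegralZl//; last exact: integrableRD.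
  apply: le_Rintegral => //.
  - exact: integrableR_energy.
  - by apply: integrableRZ; exact: integrableRD.
  move=> t _; set U := sqnormc (u t); set W := sqnormc (weak_deriv u t).
  have U0 : 0 <= U by exact: sqnormc_ge0.
  have W0 : 0 <= W by exact: sqnormc_ge0.
  suff : V a xi' t <= (1 + d) * (V a xi t + d).
    by move=> /(ler_wpM2r U0) h; have := mulr_ge0 (ltW d0) W0; lra.
  rewrite /V.
  (* Expand (d (xi + s) + (xi - xi'))^2 >= 0 and divide by d. *)
  have key s : (xi' + s) ^+ 2 <= (1 + d) * ((xi + s) ^+ 2 + d).
    have dd : d ^+ 2 = (xi - xi') ^+ 2 by rewrite real_normK// num_real.
    have := sqr_ge0 (d * (xi + s) + (xi - xi')).
    have -> : (d * (xi + s) + (xi - xi')) ^+ 2 =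
      d * ((1 + d) * ((xi + s) ^+ 2 + d) - (xi' + s) ^+ 2) +
      (1 + d) * ((xi - xi') ^+ 2 - d ^+ 2) by ring.
    by rewrite dd subrr mulr0 addr0 pmulr_rge0// subr_ge0.
  by case: ifP => _; exact: key.
set Q := q a xi u; set N := sqnormL2 u => h1 h2.
have h : mu a xi' * N <= (1 + d) * (Q + d * N) by apply: le_trans h2 h1.
rewrite mulrBl lerBlDr -mulrA ler_pdivrMl//.
Qed.

(** * The gaussian trial function *)

Lemma integrableR_oneDsqrV : integrableR (fun t : R => (1 + t ^+ 2)^-1).
Proof.
have cf : continuous (fun t : R => (1 + t ^+ 2)^-1).
  exact: (@continuous_oneDsqrV R).
have f0 (t : R) : 0 <= (1 + t ^+ 2)^-1 by rewrite invr_ge0 addr_ge0 ?sqr_ge0.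
apply/integrableP; split.
  by apply/measurable_EFinP; exact: continuous_measurable_fun.
under eq_integral => t _ do rewrite /= ger0_norm//.
rewrite ge0_symfun_integralT//; last by move=> t /=; rewrite sqrrN.
have := integral0y_oneDsqr R; rewrite /oneDsqr set_itvcy => ->.
by rewrite -EFinM ltry.
Qed.

(** Comparison with the derivative of the arc tangent. *)
Lemma integrableR_decay f K : continuous f -> (forall t, `|f t| * (1 + t ^+ 2) <= K) ->
  integrableR f.
Proof.
move=> cf fK; apply: (integrableR_le (g := fun t => K * (1 + t ^+ 2)^-1)).
- exact: continuous_measurable_fun.
- exact: integrableRZ integrableR_oneDsqrV.
- by move=> t; rewrite ler_pdivlMr// ltr_pwDl ?sqr_ge0.
Qed.

Lemma decay_cvg0 f K : (forall t, `|f t| * (1 + t ^+ 2) <= K) ->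
  f n%:R @[n --> \oo] --> (0 : R) /\ f (- n%:R) @[n --> \oo] --> (0 : R).
Proof.
move=> fK.
have K0 : 0 <= K.
  by apply: le_trans (fK 0); rewrite mulr_ge0// addr_ge0 ?sqr_ge0.
have h (s : nat -> R) : (forall n, s n ^+ 2 = n%:R ^+ 2) -> f (s n) @[n --> \oo] --> (0 : R).
  move=> sn; apply/norm_cvg0P.
  apply: (@squeeze_cvgr _ _ _ _ (fun=> 0) (fun n => K * harmonic n)).
  - apply: nearW => n; rewrite normr_ge0/= ler_pdivlMr//.
    apply: le_trans (fK (s n)); rewrite ler_wpM2l// sn -natrX -natr1 addrC lerD2l ler_nat.
    by case: n => // n; rewrite -mulnn leq_pmulr.
  - exact: cvg_cst.
  - rewrite -[X in _ --> X](mulr0 K); apply: cvgM; first exact: cvg_cst.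
    exact: cvg_harmonic.
by split; apply: h => n; rewrite ?sqrrN.
Qed.

Section gaussian.
Variable b : R.

(** Its logarithmic derivative is - (1 + b t), so it solves
    - u'' + (1 + b t)^2 u = b u. *)
Definition gauss t : R := expR (- (1 + b * t) ^+ 2 / (2 * b)).

Definition dgauss t : R := - (1 + b * t) * gauss t.

Definition ddgauss t : R := - b * gauss t - (1 + b * t) * dgauss t.

Lemma gauss_gt0 t : 0 < gauss t.
Proof. exact: expR_gt0. Qed.

Lemma C1_deriv_gauss : 0 < b -> C1_deriv gauss dgauss.
Proof.
move=> b0.
have cl := C1_derivD (C1_deriv_cst 1) (C1_derivM (C1_deriv_cst b) C1_deriv_id).
have cq := C1_derivM (C1_deriv_cst (- (2 * b)^-1)) (C1_derivM cl cl).
have := C1_deriv_comp C1_deriv_expR cq.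
have bn : b != 0 by rewrite gt_eqF.
congr C1_deriv; apply/funext => t; rewrite /dgauss /gauss /=.
  by congr expR; field.
rewrite [X in _ * expR X = _](_ : _ = - (1 + b * t) ^+ 2 / (2 * b)); last by field.
by congr (_ * _); field.
Qed.

Lemma C1_deriv_dgauss : 0 < b -> C1_deriv dgauss ddgauss.
Proof.
move=> b0.
have cl := C1_derivD (C1_deriv_cst 1) (C1_derivM (C1_deriv_cst b) C1_deriv_id).
have := C1_derivM (C1_derivM (C1_deriv_cst (-1)) cl) (C1_deriv_gauss b0).
congr C1_deriv; apply/funext => t; rewrite /ddgauss /dgauss /=; ring.
Qed.

(** The base of this power is chosen so that (1 + 2 / b^2 + 6 / b) (1 + z)
    exceeds 1 + t^2, where z = (1 + b t)^2 / (3 b), so that the squared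
    gaussian is exp (- 3 z). *)
Definition gauss_decay_cst : R := (1 + 2 / b ^+ 2 + 6 / b) ^+ 3.

(** With z as above, the inverse of the squared gaussian is (exp z)^3, and
    exp z >= 1 + z. *)
Lemma gauss_decay t : 0 < b -> (1 + t ^+ 2) ^+ 3 * gauss t ^+ 2 <= gauss_decay_cst.
Proof.
move=> b0.
have bn : b != 0 by rewrite gt_eqF.
pose z := (1 + b * t) ^+ 2 / (3 * b).
have z0 : 0 <= z by rewrite divr_ge0 ?sqr_ge0// mulr_ge0// ltW.
have gE : gauss t ^+ 2 = (expR z ^+ 3)^-1.
  rewrite /gauss -!expRM_natl -expRN; congr expR; rewrite /z; field.
  exact: bn.
have ez : 1 + z <= expR z by exact: expR_ge1Dx.
rewrite gE ler_pdivrMr ?exprn_gt0 ?expR_gt0// /gauss_decay_cst -exprMn.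
have A1 : 0 <= 2 / b ^+ 2 by rewrite divr_ge0// sqr_ge0.
have A2 : 0 <= 6 / b by rewrite divr_ge0// ltW.
have C0 : 0 <= 1 + 2 / b ^+ 2 + 6 / b by lra.
have t20 : 0 <= 1 + t ^+ 2 by rewrite addr_ge0 ?sqr_ge0.
apply: lerXn2r; rewrite ?nnegrE//; first by rewrite mulr_ge0// expR_ge0.
apply: le_trans (ler_wpM2l C0 ez).
have -> : t ^+ 2 = ((1 + b * t) - 1) ^+ 2 / b ^+ 2 by field.
rewrite -subr_ge0.
have -> : (1 + 2 / b ^+ 2 + 6 / b) * (1 + z) - (1 + (1 + b * t - 1) ^+ 2 / b ^+ 2) =
  (1 + b * t + 1) ^+ 2 / b ^+ 2 + (1 + 2 / b ^+ 2) * z + 6 / b.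
  by rewrite /z; field.
have A3 : 0 <= (1 + b * t + 1) ^+ 2 / b ^+ 2 by rewrite divr_ge0 ?sqr_ge0.
have A4 : 0 <= (1 + 2 / b ^+ 2) * z by rewrite mulr_ge0//; lra.
lra.
Qed.

(** Six powers of decay pay for a polynomial weight of degree four and still
    leave the integrable factor 1 / (1 + t^2). *)
Lemma gauss_poly_decay (k t p : R) : 0 < b -> 0 <= k -> p <= k * (1 + t ^+ 2) ^+ 2 ->
  p * gauss t ^+ 2 * (1 + t ^+ 2) <= k * gauss_decay_cst.
Proof.
move=> b0 k0 pk; apply: le_trans (ler_wpM2l k0 (gauss_decay t b0)).
have s0 : 0 <= 1 + t ^+ 2 by rewrite addr_ge0 ?sqr_ge0.
have := ler_wpM2r (mulr_ge0 s0 (sqr_ge0 (gauss t))) pk.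
by rewrite !exprS !expr0; lra.
Qed.

Lemma gauss_L2 : 0 < b -> L2R gauss.
Proof.
move=> b0.
have cg := C1_deriv_continuous (C1_deriv_gauss b0).
apply: L2I; first exact: continuous_measurable_fun.
apply: (@integrableR_decay _ (1 * gauss_decay_cst)) => t; first by apply: cvgM; exact: cg.
rewrite ger0_norm ?sqr_ge0// -[X in X * _ <= _]mul1r; apply: gauss_poly_decay => //.
by have := sqr_ge0 t; rewrite mul1r; nra.
Qed.

Lemma slope_sqr_le t : 0 < b -> b < 1 -> (b * t) ^+ 2 <= t ^+ 2.
Proof.
move=> b0 b1.
have bb : b ^+ 2 <= 1 by rewrite expr_le1 ?ltW.
by rewrite exprMn; have := ler_wpM2r (sqr_ge0 t) bb; rewrite mul1r.
Qed.

Lemma dgauss_L2 : 0 < b -> b < 1 -> L2R dgauss.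
Proof.
move=> b0 b1.
have cg := C1_deriv_continuous (C1_deriv_dgauss b0).
apply: L2I; first exact: continuous_measurable_fun.
apply: (@integrableR_decay _ (2 * gauss_decay_cst)) => t; first by apply: cvgM; exact: cg.
rewrite ger0_norm ?sqr_ge0// /dgauss exprMn; apply: gauss_poly_decay => //.
have := sqr_ge0 (b * t - 1); have := (slope_sqr_le t b0 b1).
by have := sqr_ge0 t; nra.
Qed.

Lemma tgauss_L2 : 0 < b -> L2R (fun t => t * gauss t).
Proof.
move=> b0.
have cg := C1_deriv_continuous (C1_derivM C1_deriv_id (C1_deriv_gauss b0)).
apply: L2I; first exact: continuous_measurable_fun.
apply: (@integrableR_decay _ (1 * gauss_decay_cst)) => t; first by apply: cvgM; exact: cg.
rewrite ger0_norm ?sqr_ge0// exprMn; apply: gauss_poly_decay => //.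
by have := sqr_ge0 t; rewrite mul1r; nra.
Qed.

Lemma gauss_weak_derivative : 0 < b -> b < 1 -> weak_derivative gauss dgauss.
Proof.
move=> b0 b1 phi cphi.
have cp := C1cM cphi (C1_deriv_gauss b0).
have := C1c_integral_deriv cp.
rewrite (C1_deriv_derive1 (C1_derivM (C1c_deriv cphi) (C1_deriv_gauss b0))).
have i1 : integrableR (fun t => gauss t * derive1 phi t) :=
  L2_mul_integrableR (gauss_L2 b0) (C1c_deriv_L2 cphi).
have i2 : integrableR (fun t => dgauss t * phi t) :=
  L2_mul_integrableR (dgauss_L2 b0 b1) (C1c_L2 cphi).
have -> : (fun t => derive1 phi t * gauss t + phi t * dgauss t) =
  (fun t => gauss t * derive1 phi t + dgauss t * phi t) by apply/funext => t; ring.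
by rewrite RintegralD// => /eqP; rewrite addr_eq0 => /eqP.
Qed.

(** With u the gaussian: for t < 0 the derivative of u u' is exactly the energy density minus
    b u^2.  For t > 0 the second term trades the integral of 2 t u^2, the
    gain, against integrals of t^2 u^2 and t^3 u^2 with a favourable sign. *)
Definition energy_primitive t : R :=
  gauss t * dgauss t + - (1 + b) * Num.max 0 t ^+ 2 * (gauss t * gauss t).

Definition denergy_primitive t : R :=
  dgauss t ^+ 2 + gauss t * ddgauss t
  - (1 + b) * (2 * Num.max 0 t * gauss t ^+ 2
     + Num.max 0 t ^+ 2 * (2 * gauss t * dgauss t)).

Lemma C1_deriv_energy_primitive : 0 < b -> C1_deriv energy_primitive denergy_primitive.
Proof.
move=> b0.
have c1 := C1_derivM (C1_deriv_gauss b0) (C1_deriv_dgauss b0).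
have c2 := C1_derivM (C1_derivM (C1_deriv_cst (- (1 + b))) C1_deriv_sqr_max0)
  (C1_derivM (C1_deriv_gauss b0) (C1_deriv_gauss b0)).
have := C1_derivD c1 c2.
by congr C1_deriv; apply/funext => t; rewrite /denergy_primitive; ring.
Qed.

Lemma slope_bound t : 0 < b -> b < 1 -> - ((1 + t ^+ 2) / 2) <= b * t <= (1 + t ^+ 2) / 2.
Proof.
move=> b0 b1.
rewrite -ler_norml normrM (gtr0_norm b0).
have := ler_wpM2r (normr_ge0 t) (ltW b1); rewrite mul1r.
have := sqr_ge0 (`|t| - 1); rewrite -[X in 1 + X]real_normK ?num_real//; lra.
Qed.

Lemma max0_bound t : [/\ 0 <= Num.max 0 t, Num.max 0 t <= `|t| & Num.max 0 t ^+ 2 <= t ^+ 2].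
Proof.
have h : Num.max 0 t <= `|t| by rewrite ge_max normr_ge0 ler_norm.
have h0 : 0 <= Num.max 0 t by rewrite le_max lexx.
by split=> //; rewrite -[leRHS]real_normK ?num_real// lerXn2r ?nnegrE.
Qed.

Lemma energy_primitive_decay t : 0 < b -> b < 1 ->
  `|energy_primitive t| * (1 + t ^+ 2) <= 4 * gauss_decay_cst.
Proof.
move=> b0 b1.
have [m0 m1 m2] := max0_bound t.
have -> : energy_primitive t = - ((1 + b * t) + (1 + b) * Num.max 0 t ^+ 2) * gauss t ^+ 2.
  by rewrite /energy_primitive /dgauss; ring.
rewrite normrM (ger0_norm (sqr_ge0 _)); apply: gauss_poly_decay => //.
have /andP[s1 s2] := (slope_bound t b0 b1).
have h : 0 <= (1 + b) * Num.max 0 t ^+ 2 <= 2 * t ^+ 2.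
  have q := sqr_ge0 (Num.max 0 t).
  have h1 := ler_wpM2r q (ltW b1).
  by apply/andP; split; [apply: mulr_ge0 => //; lra|lra].
move: h; set A := (1 + b) * _ => /andP[A0 A1].
rewrite normrN ler_norml; set s := 1 + t ^+ 2 in s1 s2 *.
have s_ge1 : 1 <= s by rewrite lerDl sqr_ge0.
have ss : s <= s ^+ 2 by rewrite ler_eXnr.
have A2 : A <= 2 * s by rewrite /s; lra.
by apply/andP; split; lra.
Qed.

Lemma denergy_primitive_decay t : 0 < b -> b < 1 ->
  `|denergy_primitive t| * (1 + t ^+ 2) <= 15 * gauss_decay_cst.
Proof.
move=> b0 b1.
have [m0 m1 m2] := max0_bound t.
pose m := Num.max 0 t.
have -> : denergy_primitive t = (2 * (1 + b * t) ^+ 2 - b -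
    (1 + b) * (2 * m - 2 * m ^+ 2 * (1 + b * t))) * gauss t ^+ 2.
  by rewrite /denergy_primitive /ddgauss /dgauss /m; ring.
rewrite normrM (ger0_norm (sqr_ge0 _)); apply: gauss_poly_decay => //.
have /andP[s1 s2] := (slope_bound t b0 b1).
rewrite -/m in m0 m1 m2.
set s := 1 + t ^+ 2 in s1 s2 *.
have s_ge1 : 1 <= s by rewrite lerDl sqr_ge0.
have ms : m <= s / 2.
  apply: le_trans m1 _; have := sqr_ge0 (`|t| - 1).
  by rewrite /s -[X in 1 + X]real_normK ?num_real//; lra.
have m2s : m ^+ 2 <= s by rewrite /s; lra.
have bt2 : (b * t) ^+ 2 <= s by have := (slope_sqr_le t b0 b1); rewrite /s; lra.
have e1 : (1 + b * t) ^+ 2 <= 2 * (1 + (b * t) ^+ 2) by have := sqr_ge0 (1 - b * t); lra.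
have e0 := sqr_ge0 (1 + b * t).
have X1 : - (3 * s ^+ 2) <= m ^+ 2 * (1 + b * t) <= 3 / 2 * s ^+ 2.
  have q := sqr_ge0 m; have l1 : 1 + b * t <= 3 / 2 * s by lra.
  have l2 : - (3 / 2 * s) <= 1 + b * t by lra.
  have l3 := ler_wpM2l q l1; have l4 := ler_wpM2l q l2.
  have s0 : 0 <= s by lra.
  have l5 := ler_wpM2r s0 m2s.
  by move: l5; rewrite -[s * s]expr2 => l5; apply/andP; split; lra.
have ss : s <= s ^+ 2 by rewrite ler_eXnr.
move: X1; set X := m ^+ 2 * (1 + b * t) => /andP[X1 X2].
have -> : (1 + b) * (2 * m - 2 * m ^+ 2 * (1 + b * t)) = (1 + b) * (2 * (m - X)) by rewrite /X; ring.
have Y : - (3 / 2 * s ^+ 2) <= m - X <= s ^+ 2 * (7 / 2) by apply/andP; split; lra.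
move: Y; set Y := m - X => /andP[Y1 Y2].
have Z : - (3 * s ^+ 2) <= (1 + b) * Y <= 7 * s ^+ 2.
  have h := sqr_ge0 s; have p0 : 0 <= 1 + b by lra.
  have l1 := ler_wpM2l p0 Y1; have l2 := ler_wpM2l p0 Y2.
  have l3 := ler_wpM2r h (ltW b1).
  by apply/andP; split; lra.
move: Z => /andP[Z1 Z2].
rewrite ler_norml; apply/andP; split; lra.
Qed.

Lemma integral_denergy_primitive : 0 < b -> b < 1 ->
  integrableR denergy_primitive /\ \int[leb]_t denergy_primitive t = 0.
Proof.
move=> b0 b1.
have i : integrableR denergy_primitive :=
  integrableR_decay (C1_deriv_energy_primitive b0).2 (fun t => denergy_primitive_decay t b0 b1).
have [p m] := decay_cvg0 (fun t => energy_primitive_decay t b0 b1).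
by split=> //; exact: (integral_deriv_eq0 (C1_deriv_energy_primitive b0) i p m).
Qed.

(** For t >= 0 the two sides differ, before the indicator is subtracted, by
    (1 + b) ((1 + b) t^2 + 2 b t^3) times the squared gaussian.  This is at
    least the squared gaussian at 2 when 1 <= t <= 2, which makes the
    inequality between the integrals strict. *)
Lemma gauss_energy_pointwise t : 0 < b -> b < 1 ->
  dgauss t ^+ 2 + V (- b) (-1) t * gauss t ^+ 2 - b * gauss t ^+ 2
  <= denergy_primitive t - gauss 2 ^+ 2 * \1_(`[1, 2]%classic : set R) t.
Proof.
move=> b0 b1.
rewrite indicE mem_setE in_itv/=; case: (ltP t 0) => t0.
  have -> : (1 <= t) = false by apply/negbTE; rewrite -ltNge; lra.
  rewrite /denergy_primitive /V t0 (max_idPl (ltW t0)) /ddgauss /dgauss /=.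
  by rewrite le_eqVlt; apply/orP; left; apply/eqP; ring.
rewrite /V ltNge t0 /=; rewrite -subr_ge0.
have -> : denergy_primitive t - gauss 2 ^+ 2 * (1 <= t <= 2)%R%:R -
    (dgauss t ^+ 2 + (-1 + t) ^+ 2 * gauss t ^+ 2 - b * gauss t ^+ 2) =
  (1 + b) * ((1 + b) * t ^+ 2 + 2 * b * (t * t ^+ 2)) * gauss t ^+ 2
    - gauss 2 ^+ 2 * (1 <= t <= 2)%R%:R.
  by rewrite /denergy_primitive /ddgauss /dgauss (max_idPr t0); ring.
have P0 : 0 <= b * (t * t ^+ 2) by rewrite mulr_ge0 ?(ltW b0)// mulr_ge0 ?sqr_ge0.
have [/andP[t1 t2]|_] := boolP (1 <= t <= 2); last first.
  rewrite mulr0 subr0 mulr_ge0 ?sqr_ge0// mulr_ge0//; first by lra.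
  by rewrite addr_ge0//; [rewrite mulr_ge0 ?sqr_ge0//; lra|lra].
rewrite mulr1 subr_ge0.
have g2 : gauss 2 ^+ 2 <= gauss t ^+ 2.
  apply: lerXn2r; rewrite ?nnegrE ?(ltW (gauss_gt0 _))// /gauss ler_expR.
  rewrite !mulNr lerN2 ler_pM2r ?invr_gt0 ?mulr_gt0//.
  by apply: lerXn2r; rewrite ?nnegrE; nra.
apply: le_trans g2 _; rewrite ler_peMl ?sqr_ge0//.
have : 1 <= t ^+ 2 by rewrite expr_ge1.
nra.
Qed.

Lemma gauss_energy_lt : 0 < b -> b < 1 ->
  \int[leb]_t (dgauss t ^+ 2 + V (- b) (-1) t * gauss t ^+ 2) <
  b * \int[leb]_t (gauss t ^+ 2).
Proof.
move=> b0 b1.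
have [di d0] := (integral_denergy_primitive b0 b1).
have g2 := L2_sqr_integrableR (gauss_L2 b0).
have dg2 := L2_sqr_integrableR (dgauss_L2 b0 b1).
have Vg := integrableR_V (- b) (-1) (gauss_L2 b0) (tgauss_L2 b0).
have ii : integrableR (\1_(`[1, 2]%classic : set R)) by exact: integrable_indic_itv.
have ki := integrableRZ (gauss 2 ^+ 2) ii.
rewrite -RintegralZl// -subr_lt0 -RintegralB//; [|exact: integrableRD|exact: integrableRZ].
apply: le_lt_trans (_ : \int[leb]_t (denergy_primitive t -
    gauss 2 ^+ 2 * \1_(`[1, 2]%classic : set R) t) < 0).
  apply: le_Rintegral => //.
  - by apply: integrableRB; [exact: integrableRD|exact: integrableRZ].
  - exact: integrableRB.
  by move=> t _; exact: gauss_energy_pointwise.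
rewrite RintegralB// d0 sub0r oppr_lt0 RintegralZl// mulr_gt0 ?exprn_gt0 ?gauss_gt0//.
have mI : lebesgue_measure (`[1, 2]%classic : set R) = 1%:E.
  by rewrite lebesgue_measure_itv/= lte_fin ltr1n -EFinB; congr EFin; lra.
have -> : \int[leb]_t \1_(`[1, 2]%classic : set R) t =
    fine (lebesgue_measure (`[1, 2]%classic : set R)).
  by rewrite /Rintegral integral_indic// setIT.
by rewrite mI.
Qed.

End gaussian.

(** * Minimization over the real line *)

Definition gauss_trial b (t : R) : R[i] := (gauss b t)%:C%C.

Lemma L2_zero : L2R (fun=> 0).
Proof.
apply: (@L2_compact_support _ 0); last by [].
by move=> t; exact: cvg_cst.
Qed.

Lemma trial_L2_derivative b : 0 < b -> b < 1 ->
  L2_derivative (gauss_trial b) (fun t => (dgauss b t)%:C%C).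
Proof.
move=> b0 b1; split; first by split; [exact: dgauss_L2|exact: L2_zero].
- exact: gauss_weak_derivative.
- move=> phi _ /=.
  by under eq_Rintegral do rewrite mul0r; under [in RHS]eq_Rintegral do rewrite mul0r;
    rewrite Rintegral_cst// mul0r oppr0.
Qed.

Lemma trial_B1 b : 0 < b -> b < 1 -> B1 (gauss_trial b).
Proof.
move=> b0 b1; split.
- by split; [exact: gauss_L2|exact: L2_zero].
- by exists (fun t => (dgauss b t)%:C%C); exact: trial_L2_derivative.
- split.
  + by under eq_fun do rewrite Re_mul_real/=; exact: tgauss_L2.
  + by under eq_fun do rewrite Im_mul_real/= mulr0; exact: L2_zero.
Qed.

Lemma trial_nonnull b : nonnull (gauss_trial b).
Proof.
have h t : gauss_trial b t <> 0.
  by move=> /(congr1 (@complex.Re R)) /=; apply/eqP; rewrite gt_eqF// gauss_gt0.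
move=> [N [mN N0]]; have -> : ~` [set t | gauss_trial b t = 0] = setT.
  by apply/seteqP; split=> // t _ /=; exact: h.
rewrite subTset => NT; move: N0; rewrite NT.
have : (lebesgue_measure `[0%R, 1%R]%classic <= leb setT)%E by apply: le_measure; rewrite ?inE.
rewrite lebesgue_measure_itv/= lte_fin ltr01 -EFinB subr0 => /[swap] -> /=.
by rewrite lee_fin ler10.
Qed.

Lemma mu_at_minus1_lt (b : R) : 0 < b -> b < 1 -> mu (- b) (-1) < b.
Proof.
move=> b0 b1; have tB := trial_B1 b0 b1.
have n0 := sqnormL2_gt0 tB (@trial_nonnull b).
apply: le_lt_trans (mu_le (- b) (-1) tB (@trial_nonnull b)) _.
rewrite ltr_pdivrMr// (q_eq_weak_derivative _ _ tB (trial_L2_derivative b0 b1)).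
have := gauss_energy_lt b0 b1; congr (_ < _ * _).
- by apply: eq_Rintegral => t _; rewrite /sqnormc /= expr0n/= !addr0.
- by apply: eq_Rintegral => t _; rewrite /sqnormc /= expr0n/= addr0.
Qed.

(** The hypothesis, used in both directions, bounds |f y - f x| by
    |x - y| (f x + 2) when |x - y| <= 1. *)
Lemma continuous_perturb f : (forall x, 0 <= f x) ->
  (forall x y, x != y -> f y <= (1 + `|x - y|) * (f x + `|x - y|)) ->
  continuous f.
Proof.
move=> f0 fxy x.
have key y z : `|y - z| <= 1 -> f z - f y <= `|y - z| * (f y + 2).
  have [->|yz] := eqVneq y z; first by rewrite !subrr normr0 mul0r.
  have := fxy _ _ yz; have := normr_ge0 (y - z).
  set d := `|y - z| => d0 h d1; have := ler_wpM2l d0 d1; lra.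
apply/cvgrPdist_le => e e0.
have M0 : 0 < f x + 2 by have := f0 x; lra.
near=> y.
have y1 : `|x - y| <= 1.
  by near: y; apply: cvgr_dist_le; [exact: cvg_id|exact: ltr01].
have yd : `|x - y| * (f x + 2) <= e.
  rewrite -ler_pdivlMr//.
  by near: y; apply: cvgr_dist_le; [exact: cvg_id|rewrite divr_gt0].
have k1 := key x y y1; have := key y x; rewrite distrC => /(_ y1) k2.
rewrite ler_norml; apply/andP; split; first by lra.
have [yx|xy] := leP (f y) (f x); last by lra.
have : `|x - y| * (f y + 2) <= `|x - y| * (f x + 2) by rewrite ler_wpM2l// lerD2r.
lra.
Unshelve. all: by end_near. Qed.

Lemma mu_continuous (a : R) (u0 : R -> R[i]) : B1 u0 -> nonnull u0 ->
  continuous (mu a : R -> R).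
Proof.
move=> u0B u0n; apply: continuous_perturb => [x|x y xy].
  by apply: (mu_ge u0B u0n) => u uB _; rewrite mul0r q_ge0.
exact: mu_perturb u0B u0n xy.
Qed.

End piecewise_parabolic_ground_energy.

Theorem theorem2p8 (R : realType) (a : R) (ha : -1 < a) (ha0 : a < 0) :
  (exists xi : R, xi < 0 /\ mu a xi < `|a|) /\
  (exists xi0 : R, (forall xi : R, mu a xi0 <= mu a xi) /\ mu a xi0 < `|a|).
Proof.
pose b := - a; have b0 : 0 < b by rewrite oppr_gt0.
have b1 : b < 1 by rewrite /b; lra.
have -> : a = - b by rewrite opprK.
rewrite normrN (gtr0_norm b0).
have tB := trial_B1 b0 b1; have tn := @trial_nonnull R b.
have m1 := mu_at_minus1_lt b0 b1.
split; first by exists (-1); split=> //; lra.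
pose e := b - mu (- b) (-1); have e0 : 0 < e by rewrite subr_gt0.
(* For x > M one has x^2 >= x > 36 / e, hence b - 36 / x^2 > mu (-1). *)
pose M := 1 + 36 / e.
have M1 : 1 < M by rewrite ltrDl divr_gt0.
have NM : - M <= 1 by lra.
have cc : {within `[- M, 1], continuous (mu (- b) : R -> R)}.
  by apply: continuous_subspaceT; exact: mu_continuous tB tn.
have [c _ cmin] := EVT_min NM cc.
have c1 : mu (- b) c <= mu (- b) (-1) by apply: cmin; rewrite in_itv/=; apply/andP; split; lra.
exists c; split; last exact: le_lt_trans m1.
move=> xi; have [xM|Mx] := leP (- M) xi; last first.
  apply: le_trans c1 _.
  pose x := - xi; have xM : M < x by rewrite /x; lra.
  have x0 : 0 < x by lra.
  have -> : xi = - x by rewrite opprK.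
  apply: le_trans (mu_ge_far tB tn b0 (ltW b1) x0).
  have : 36 / x ^+ 2 <= e.
    rewrite ler_pdivrMr ?exprn_gt0//.
    have : 36 <= e * x by rewrite mulrC -ler_pdivrMr//; move: xM; rewrite /M; lra.
    have : e * x * 1 <= e * x * x by rewrite ler_wpM2l ?mulr_ge0 ?(ltW e0) ?(ltW x0)//; lra.
    by rewrite expr2 mulrA; lra.
  by rewrite /e; lra.
have [x1|x1] := leP xi 1; first by apply: cmin; rewrite in_itv/= xM.
apply: le_trans c1 _; apply: le_trans (mu_ge_sqr tB tn (ltW b0) (_ : 0 <= xi)); last by lra.
have : 1 <= xi ^+ 2 by rewrite expr_ge1//; lra.
lra.
Qed.
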